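(* In the online regression setting and with the adaptive Huber regression procedure described in the context, suppose that $\nu_t/\hat\nu_t\le b$ for all $t\le T$, and set $$c_0=\frac{1}{\sqrt{23\log\frac{2T^2}{\delta}}},\qquad c_1=\frac{(\log 3T)^{\frac{1-\epsilon}{1+\epsilon}}}{48\left(\log\frac{2T^2}{\delta}\right)^{\frac{2}{1+\epsilon}}},\qquad \tau_0=\frac{\sqrt{2\kappa}\,b\,(\log 3T)^{\frac{1-\epsilon}{2(1+\epsilon)}}}{\left(\log\frac{2T^2}{\delta}\right)^{\frac{1}{1+\epsilon}}}.$$ Then for any $\delta\in(0,1)$, with probability at least $1-3\delta$, for all $1\le t\le T$, $$\|\theta_t-\theta^*\|_{H_t}\le\beta_t,\qquad \beta_t=3\sqrt{\lambda}\,B+24\,t^{\frac{1-\epsilon}{2(1+\epsilon)}}\sqrt{2\kappa}\,b\,(\log 3T)^{\frac{1-\epsilon}{2(1+\epsilon)}}\left(\log\frac{2T^2}{\delta}\right)^{\frac{\epsilon}{1+\epsilon}}.$$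
   Context: Notation: $\|x\|_A=\sqrt{x^\top A x}$ for positive definite $A$; $\mathcal B_d(r)=\{x\in\mathbb R^d:\|x\|_2\le r\}$; $\log$ is the natural logarithm. Online regression with heavy-tailed noise. Fix $\epsilon\in(0,1]$, integers $d,T\ge1$, and $L,B>0$. Let $(\mathcal F_t)_{t\ge0}$ be a filtration. For each $t\ge 1$, $y_t,\varepsilon_t$ are $\mathcal F_t$-measurable real random variables and $\phi_t\in\mathcal B_d(L)$ is an $\mathcal F_{t-1}$-measurable random vector, with $y_t=\langle\phi_t,\theta^*\rangle+\varepsilon_t$, where $\theta^*\in\mathcal B_d(B)$ is an unknown deterministic vector, $\mathbb E[\varepsilon_t|\mathcal F_{t-1}]=0$ and $\mathbb E[|\varepsilon_t|^{1+\epsilon}|\mathcal F_{t-1}]=\nu_t^{1+\epsilon}$. Huber loss: for $\tau>0$, $\ell_\tau(x)=x^2/2$ if $|x|\le\tau$ and $\ell_\tau(x)=\tau|x|-\tau^2/2$ if $|x|>\tau$. Adaptive Huber regression. Inputs: $T$, $\delta\in(0,1)$, $\lambda>0$, $\sigma_{\min}>0$, $c_0,c_1,\tau_0>0$, a constant $b>0$, and nonnegative $\mathcal F_{t-1}$-measurable estimates $\hat\nu_t$ of $\nu_t$. Put $\kappa=d\log\left(1+\frac{TL^2}{d\lambda\sigma_{\min}^2}\right)$ and $H_t=\lambda I+\sum_{s=1}^{t}\sigma_s^{-2}\phi_s\phi_s^\top$ ($H_0=\lambda I$), where recursively $$\sigma_t=\max\left\{\hat\nu_t,\ \sigma_{\min},\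 \frac{\|\phi_t\|_{H_{t-1}^{-1}}}{c_0},\ \frac{\sqrt{LB}}{c_1^{1/4}(2\kappa b^2)^{1/4}}\|\phi_t\|_{H_{t-1}^{-1}}^{1/2}\right\},$$ $w_t=\|\phi_t/\sigma_t\|_{H_{t-1}^{-1}}$ and $\tau_t=\tau_0\frac{\sqrt{1+w_t^2}}{w_t}t^{\frac{1-\epsilon}{2(1+\epsilon)}}$ (with $\tau_t=+\infty$, i.e. $\ell_{\tau_t}(x)=x^2/2$, if $w_t=0$). The estimator is $$\theta_t=\operatorname*{argmin}_{\theta\in\mathcal B_d(B)}L_t(\theta),\qquad L_t(\theta)=\frac\lambda2\|\theta\|_2^2+\sum_{s=1}^t\ell_{\tau_s}\left(\frac{y_s-\langle\phi_s,\theta\rangle}{\sigma_s}\right).$$ *)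

(* Defs.v *)
From mathcomp Require Import all_boot all_order all_algebra.
From mathcomp Require Import all_classical all_reals all_analysis.

Set Implicit Arguments.
Unset Strict Implicit.
Unset Printing Implicit Defensive.

Import Order.TTheory GRing.Theory Num.Theory.

Local Open Scope classical_set_scope.
Local Open Scope ring_scope.

Section Vectors.
Context {R : realType} {d : nat}.
Implicit Types (A : 'M[R]_d) (x y : 'cV[R]_d).

Definition dotv x y : R := (x^T *m y) 0 0.

(* The norm `|x| of the library is the sup norm on matrices. *)
Definition norm2 x : R := Num.sqrt (dotv x x).

Definition mnorm A x : R := Num.sqrt (dotv x (A *m x)).

Definition ball2 (r : R) : set 'cV[R]_d := [set x | norm2 x <= r].

End Vectors.

Definition is_argmin (R : realType) (X : Type) (D : set X) (f : X -> R)
    (x : X) : Prop :=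
  D x /\ forall z, D z -> f x <= f z.

Section Probability.
Context {d0 : measure_display} {Omega : measurableType d0} {R : realType}.

Definition is_filtration (F : nat -> set (set Omega)) : Prop :=
  [/\ forall t, sigma_algebra setT (F t),
      forall t, F t `<=` measurable
    & forall s t, (s <= t)%N -> F s `<=` F t].

Definition sub_measurable (G : set (set Omega)) (X : Omega -> R) : Prop :=
  forall B : set R, measurable B -> G (X @^-1` B).

(* Borel measurability in R^d is measurability of the coordinates. *)
Definition sub_measurable_vec (d : nat) (G : set (set Omega))
    (X : Omega -> 'cV[R]_d) : Prop :=
  forall i, sub_measurable G (fun w => X w i 0).

(* Y is a version of E[X | G]; X must be integrable, or nonnegative, in which
   case both integrals may be infinite. *)
Definition is_cond_exp (P : probability Omega R) (G : set (set Omega))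
    (X Y : Omega -> R) : Prop :=
  [/\ P.-integrable setT (EFin \o X) \/
        (measurable_fun setT X /\ forall w, 0 <= X w),
      sub_measurable G Y
    & forall A, G A ->
        (\int[P]_(w in A) (X w)%:E = \int[P]_(w in A) (Y w)%:E)%E].

(* A measure of the library is only meaningful on measurable sets; for a
   measurable E this says p <= P E. *)
Definition with_prob_ge (P : probability Omega R) (p : R) (E : set Omega)
    : Prop :=
  exists2 E' : set Omega, measurable E' /\ E' `<=` E & (p%:E <= P E')%E.

End Probability.

(* The value tau = +oo gives the squared loss. *)
Definition huber (R : realType) (tau : \bar R) (x : R) : R :=
  if (`|x|%:E <= tau)%E then x ^+ 2 / 2
  else fine tau * `|x| - fine tau ^+ 2 / 2.

Record ahr_params (R : realType) := AhrParams {
  ahr_T : nat;       (* horizon *)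
  ahr_eps : R;       (* moments of order 1 + eps *)
  ahr_L : R;         (* radius of the ball of features *)
  ahr_B : R;         (* radius of the ball of parameters *)
  ahr_lambda : R;
  ahr_sigma_min : R;
  ahr_c0 : R;
  ahr_c1 : R;
  ahr_tau0 : R;
  ahr_b : R          (* bound on nu / nuhat *)
}.

(* The procedure is deterministic given one trajectory of nuhat, phi and y;
   indices start at 1 and the values at 0 are never used. *)
Section AdaptiveHuber.
Context {R : realType} {d : nat}.
Variable p : ahr_params R.

Local Notation T := (ahr_T p).
Local Notation eps := (ahr_eps p).
Local Notation L := (ahr_L p).
Local Notation B := (ahr_B p).
Local Notation lambda := (ahr_lambda p).
Local Notation smin := (ahr_sigma_min p).
Local Notation c0 := (ahr_c0 p).
Local Notation c1 := (ahr_c1 p).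
Local Notation tau0 := (ahr_tau0 p).
Local Notation b := (ahr_b p).

Definition ahr_kappa : R :=
  d%:R * ln (1 + T%:R * L ^+ 2 / (d%:R * lambda * smin ^+ 2)).

Definition ahr_sigma_step (H : 'M[R]_d) (nuh : R) (x : 'cV[R]_d) : R :=
  let r := mnorm (invmx H) x in
  Num.max nuh (Num.max smin (Num.max (r / c0)
    (Num.sqrt (L * B) / (c1 `^ 4^-1 * (2 * ahr_kappa * b ^+ 2) `^ 4^-1)
       * Num.sqrt r))).

Variables (nuhat : nat -> R) (phi : nat -> 'cV[R]_d).

Fixpoint ahr_H (t : nat) : 'M[R]_d :=
  match t with
  | 0 => lambda%:M
  | s.+1 => ahr_H s
      + (ahr_sigma_step (ahr_H s) (nuhat s.+1) (phi s.+1)) ^- 2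
          *: (phi s.+1 *m (phi s.+1)^T)
  end.

Definition ahr_sigma (t : nat) : R :=
  ahr_sigma_step (ahr_H t.-1) (nuhat t) (phi t).

Lemma ahr_HE (t : nat) :
  ahr_H t = lambda%:M
    + \sum_(1 <= s < t.+1) (ahr_sigma s) ^- 2 *: (phi s *m (phi s)^T).
Proof.
elim: t => [|t IH]; first by rewrite big_geq// addr0.
by rewrite big_nat_recr//= addrA -IH.
Qed.

Definition ahr_w (t : nat) : R :=
  mnorm (invmx (ahr_H t.-1)) ((ahr_sigma t)^-1 *: phi t).

Definition ahr_tau (t : nat) : \bar R :=
  if ahr_w t == 0 then +oo%E
  else (tau0 * (Num.sqrt (1 + ahr_w t ^+ 2) / ahr_w t)
          * t%:R `^ ((1 - eps) / (2 * (1 + eps))))%:E.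

Variable y : nat -> R.

Definition ahr_loss (t : nat) (theta : 'cV[R]_d) : R :=
  lambda / 2 * norm2 theta ^+ 2
  + \sum_(1 <= s < t.+1)
      huber (ahr_tau s) ((y s - dotv (phi s) theta) / ahr_sigma s).

Definition is_ahr_estimator (t : nat) (theta : 'cV[R]_d) : Prop :=
  is_argmin (ball2 B) (ahr_loss t) theta.

End AdaptiveHuber.

Definition ahr_beta (R : realType) (d : nat) (p : ahr_params R) (delta : R)
    (t : nat) : R :=
  let e := (1 - ahr_eps p) / (2 * (1 + ahr_eps p)) in
  let ell := ln (2 * (ahr_T p)%:R ^+ 2 / delta) in
  3 * Num.sqrt (ahr_lambda p) * ahr_B p
  + 24 * t%:R `^ e * Num.sqrt (2 * ahr_kappa (d := d) p) * ahr_b p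
      * ln (3 * (ahr_T p)%:R) `^ e
      * ell `^ (ahr_eps p / (1 + ahr_eps p)).

(* Main.v *)
(* Write u_s = phi_s / sigma_s, z_s = noise_s / sigma_s, S_t = sum_(s <= t) psi_s u_s,
   where psi_s is z_s truncated at tau_s, and v_s = w_s^2 / (1 + w_s^2).

   Deterministic part. The Huber gradient at theta_star is lambda theta_star - S_t.
   Along theta_t - theta_star it has full curvature u_s u_s^T at every s with
   |z_s| <= tau_s / 2, because the choice of sigma_s keeps the change of the residual
   below tau_s / 2. So if the bad indices carry total weight sum v_s <= 1/2, optimality
   gives |theta_t - theta_star|_{H_t} <= 2 (sqrt lambda B + |S_t|_{H_t^-1}).
   Sherman-Morrison yields the recursion
   |S_t|^2 <= |S_{t-1}|^2 + 2 psi_t g_t / (1 + w_t^2) + psi_t^2 v_t,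
   with g_t = u_t^T H_{t-1}^-1 S_{t-1}.

   Stochastic part. The three sums (bad weight, cross terms, squares), suitably
   normalized, have increments X with exp X <= 1 + a noise + q |noise|^(1 + eps), where
   a and q are predictable. Integrating against a predictable weight kills the linear
   term and replaces the moment by its bound (b / tau_s)^(1 + eps) up to a factor, so
   that exp of the compensated sum is a supermartingale and Markov's inequality
   applies. Hoelder's inequality, the elliptical potential bound sum v_s <= kappa and
   sum 1/s <= log (3T) show that the sum of (b / tau_s)^(1 + eps) is at most
   log (2T^2 / delta). *)
From mathcomp Require Import all_boot all_order all_algebra.
From mathcomp Require Import ring lra.
From mathcomp Require Import all_classical all_reals all_analysis.
From mathcomp Require Import measurable_realfun.
Require Import Defs.

Set Implicit Arguments.
Unset Strict Implicit.
Unset Printing Implicit Defensive.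

Import Order.TTheory GRing.Theory Num.Theory.

Local Open Scope classical_set_scope.
Local Open Scope ring_scope.

(** * Real inequalities *)

(** Clipping heavy-tailed noise leaves a bias, and the clipped noise is never recentred. Each cross
    increment is compared with the raw noise, which has conditional mean zero; the clipping error
    and the second-order term of exp both go into the moment of order 1 + eps. Hence only the two
    given conditional moments are ever integrated. Because tau_s carries a factor s^e with e = (1 -
    eps) / (2 (1 + eps)), the quadratic and cross sums up to t are normalized by tau0 t^e, uniformly
    in s <= t. Each t thus has its own supermartingales, and the failure probabilities are added
    over t: 3T events of probability at most exp (- ell) = delta / (2 T^2), where ell = log (2 T^2 /
    delta). The thresholds of the three sums are their compensator bounds 4 ell, ell and ell, plus a
    deviation ell; the numbers 23 and 24 of the theorem leave room for them. The estimators enter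
    only pointwise, as minimizers, so the exceptional event is built from the noise, the features
    and nuhat alone. *)

Section RealInequalities.
Context {R : realType}.
Implicit Types x y z i : R.

Lemma powRV x y : 0 <= x -> x^-1 `^ y = (x `^ y)^-1.
Proof. by move=> x0; rewrite -powR_inv1// powRAC powR_inv1// powR_ge0. Qed.

(** From exp (- x) >= 1 - x follows (1 - x) exp x <= 1, while (1 - x) (1 + x + 2 x^2) = 1 + x^2 (1 -
    2x) is at least 1 on this range. The range contains all negative x, as the cross increments
    change sign. *)
Lemma expR_le_quad x : x <= 2^-1 -> expR x <= 1 + x + 2 * x ^+ 2.
Proof.
move=> x2; have /= := expR_ge1Dx (- x); rewrite expRN => h.
have e0 := expR_gt0 x.
have h1 : (1 - x) * expR x <= 1.
  by rewrite -[leRHS](mulVf (lt0r_neq0 e0)) ler_pM2r.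
have h2 : 0 <= (2^-1 - x) * x ^+ 2 by rewrite mulr_ge0 ?sqr_ge0 ?subr_ge0.
have x1 : 0 < 1 - x by lra.
rewrite -(ler_pM2l x1) (le_trans h1)//.
have -> : (1 - x) * (1 + x + 2 * x ^+ 2) = 1 + 2 * ((2^-1 - x) * x ^+ 2).
  by field.
by lra.
Qed.

Lemma weighted_AMGM (a x y : R) : 0 < a <= 1 -> 0 <= x -> 0 < y ->
  x `^ a * y `^ (1 - a) <= a * x + (1 - a) * y.
Proof.
move=> /andP[a0 a1] x0 y0; have [->|xn0] := eqVneq x 0.
  by rewrite powR0 ?gt_eqF// mul0r mulr0 add0r mulr_ge0 ?subr_ge0// ltW.
have {xn0}x0 : 0 < x by rewrite lt_neqAle eq_sym xn0.
pose m := a * x + (1 - a) * y.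
have m0 : 0 < m by rewrite ltr_pwDl ?mulr_gt0// mulr_ge0 ?subr_ge0// ltW.
(* Tangent of ln at the weighted mean [m]; in the average of the bounds at x and y the linear parts
   cancel. *)
have ln_bd t : 0 < t -> ln t <= ln m + (t / m - 1).
  move=> t0; rewrite -lerBlDl -ln_div ?posrE//.
  have tm : 0 < t / m by rewrite divr_gt0.
  have := @le_ln1Dx R (t / m - 1); rewrite subrKC; apply; lra.
rewrite /powR !gt_eqF// -expRD -[leRHS](@lnK R) ?posrE// ler_expR.
have h1 := ler_wpM2l (ltW a0) (ln_bd _ x0).
have a1' : 0 <= 1 - a by rewrite subr_ge0.
have h2 := ler_wpM2l a1' (ln_bd _ y0).
rewrite (le_trans (lerD h1 h2))// -/m.
rewrite [leLHS](_ : _ = ln m + (m / m - 1)); last by rewrite /m; ring.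
by rewrite divff ?gt_eqF// subrr addr0.
Qed.

Lemma ln2_ge : 2^-1 <= ln 2 :> R.
Proof.
have := @le_ln1Dx R (- 2^-1).
rewrite (_ : 1 - 2^-1 = 2^-1 :> R); last by field.
by rewrite lnV ?posrE//; lra.
Qed.

(* exp (1/6) <= 6/5 and (6/5)^6 < 3. *)
Lemma ln3_ge1 : 1 <= ln 3 :> R.
Proof.
have h := @expR_ge1Dx R (- 6^-1); rewrite expRN in h.
have e0 := expR_gt0 (6^-1 : R).
have h1 : expR 6^-1 <= 6 / 5 :> R.
  rewrite -[leLHS]invrK -[6 / 5]invrK lef_pV2 ?posrE ?invr_gt0//; lra.
rewrite -ler_expR lnK ?posrE// -[1 in leLHS](@mulfV R 6) ?pnatr_eq0//.
rewrite expRM_natl (le_trans (y := (6 / 5) ^+ 6))//; last by lra.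
by rewrite lerXn2r ?nnegrE// ltW.
Qed.

(** The classical 1 + ln n, with the 1 absorbed as ln 3: the origin of the 3T in the constants. *)
Lemma harmonic_le_ln (n : nat) : (1 <= n)%N ->
  \sum_(1 <= s < n.+1) s%:R^-1 <= ln (3 * n%:R) :> R.
Proof.
move=> n1; rewrite lnM ?posrE ?ltr0n//.
suff h : \sum_(1 <= s < n.+1) s%:R^-1 <= 1 + ln n%:R :> R.
  by rewrite (le_trans h)// lerD2r ln3_ge1.
elim: n n1 => // -[|n] IH _; first by rewrite big_nat1 invr1 ln1 addr0.
rewrite big_nat_recr//= (le_trans (lerD (IH isT) (lexx _)))//.
rewrite -addrA lerD2l -lerBrDl.
have n0 : 0 < n.+1%:R :> R by rewrite ltr0n.
have n0' : 0 < n.+2%:R :> R by rewrite ltr0n.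
rewrite -ln_div ?posrE//.
have := @le_ln1Dx R (- n.+2%:R^-1).
have -> : 1 - n.+2%:R^-1 = (n.+2%:R / n.+1%:R)^-1 :> R.
  rewrite -[n.+2%:R]natr1 in n0' *.
  by field; rewrite !(addrC 1) natr1 !gt_eqF// addrC.
rewrite lnV ?posrE ?divr_gt0// => h.
have : -1 < - n.+2%:R^-1 :> R by rewrite ltrN2 invf_lt1// ltr1n.
by move/h; rewrite lerN2.
Qed.

(** Hölder's inequality with exponents 1/a and 1/(1 - a), by normalization: AM-GM is applied
    termwise to [v s / A] and [s%:R^-1 / l], whose sums are at most 1. *)
Lemma holder_harmonic (n : nat) (a A : R) (v : nat -> R) : (1 <= n)%N ->
  0 < a <= 1 -> 0 < A -> (forall s, 0 <= v s) ->
  \sum_(1 <= s < n.+1) v s <= A ->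
  \sum_(1 <= s < n.+1) v s `^ a * s%:R^-1 `^ (1 - a)
    <= A `^ a * ln (3 * n%:R) `^ (1 - a).
Proof.
move=> n1 a01 A0 v0 vA.
set l := ln _.
have l0 : 0 < l.
  by rewrite ln_gt0// (lt_le_trans (y := 3))// ?ler_peMr// ?ler1n// ltr1n.
have /andP[a0 a1] := a01.
have C0 : 0 < A `^ a * l `^ (1 - a) by rewrite mulr_gt0// powR_gt0.
rewrite -[leRHS]mulr1 -ler_pdivrMl// big_distrr/=.
apply: (le_trans (y := \sum_(1 <= s < n.+1)
     (a / A * v s + (1 - a) / l * s%:R^-1))).
  apply: ler_sum_nat => s /andP[s1 _].
  have s0 : 0 < s%:R^-1 :> R by rewrite invr_gt0 ltr0n.
  have := @weighted_AMGM a (v s / A) (s%:R^-1 / l) a01.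
  rewrite divr_ge0// ?divr_gt0// ?(ltW A0)// => /(_ isT isT).
  rewrite !powRM ?invr_ge0 ?(ltW A0) ?(ltW l0) ?(ltW s0)//.
  rewrite !powRV ?(ltW A0) ?(ltW l0) ?ler0n//.
  set x1 := v s `^ a; set y1 := (s%:R `^ _)^-1 => h.
  rewrite invfM; apply: le_trans (le_trans h _); last by rewrite le_eqVlt; apply/orP; left; apply/eqP; ring.
  by rewrite le_eqVlt; apply/orP; left; apply/eqP; ring.
rewrite big_split/= -!big_distrr/=.
have h2 := harmonic_le_ln n1.
have h3 : a / A * \sum_(1 <= s < n.+1) v s <= a.
  by rewrite -mulrA ger_pMr// ler_pdivrMl// mulr1.
have h4 : (1 - a) / l * \sum_(1 <= s < n.+1) s%:R^-1 <= 1 - a.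
  by rewrite -mulrA ler_piMr ?subr_ge0// ler_pdivrMl// mulr1.
by rewrite (le_trans (lerD h3 h4))// subrKC.
Qed.

(** Stands in for a one-sided derivative at 0. For G < 0 the step h = - G / (2m) with m = C + 1 - G
    is at most 1, and the expression equals (G / (2m))^2 (C - 2m) < 0. *)
Lemma linear_coef_ge0 (G C : R) : 0 <= C ->
  (forall h, 0 < h <= 1 -> 0 <= h * G + h ^+ 2 * C) -> 0 <= G.
Proof.
move=> C0 hG; rewrite leNgt; apply/negP => G0.
pose m := C + 1 - G.
have m0 : 0 < m by rewrite /m; lra.
have := hG (- G / (2 * m)).
rewrite divr_gt0 ?mulr_gt0 ?oppr_gt0//= ler_pdivrMr ?mulr_gt0// mul1r.
have -> : - G <= 2 * m by rewrite /m; lra.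
move=> /(_ isT).
have -> : - G / (2 * m) * G + (- G / (2 * m)) ^+ 2 * C
  = (G / (2 * m)) ^+ 2 * (C - 2 * m) by field; rewrite gt_eqF.
rewrite leNgt => /negP; apply; rewrite pmulr_rlt0; first by rewrite /m; lra.
by rewrite -sqrrN exprn_gt0// oppr_gt0 pmulr_llt0// invr_gt0 mulr_gt0.
Qed.

End RealInequalities.

(* The truncation of z to [- 1/i, 1/i]; i = 0 stands for the level +oo. *)
Definition clip (R : realType) (i z : R) : R := z / Num.max 1 (`|z| * i).

(** * Truncation as a projection, and the Huber loss *)

Section Clip.
Context {R : realType}.
Implicit Types x y z i eps : R.

Lemma clip_id i z : `|z| * i <= 1 -> clip i z = z.
Proof. by move=> zi; rewrite /clip max_l// divr1. Qed.

Lemma clip_sat i z : 1 < `|z| * i -> clip i z = Num.sg z / i.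
Proof.
move=> zi; rewrite /clip max_r ?ltW//.
have z0 : z != 0 by apply: contraTneq zi => ->; rewrite normr0 mul0r ltr10.
have i0 : i != 0 by apply: contraTneq zi => ->; rewrite mulr0 ltr10.
rewrite {1}[z]numEsg; field.
by rewrite i0 normr_eq0 z0.
Qed.

Lemma norm_clip i z : 0 <= i -> `|clip i z| * i = Num.min 1 (`|z| * i).
Proof.
move=> i0; have [zi|zi] := leP (`|z| * i) 1; first by rewrite clip_id.
rewrite clip_sat// normf_div normr_sg.
have z0 : z != 0 by apply: contraTneq zi => ->; rewrite normr0 mul0r ltr10.
have i0' : i != 0 by apply: contraTneq zi => ->; rewrite mulr0 ltr10.
by rewrite z0 mul1r ger0_norm// mulVf.
Qed.

Lemma norm_clip_le1 i z : 0 <= i -> `|clip i z| * i <= 1.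
Proof. by move=> i0; rewrite norm_clip// ge_min lexx. Qed.

(** With r = |z| i the left side is min (1, r)^2. For r <= 1 use 1 + eps <= 2; for r > 1 the right
    side exceeds 1. This trades the second moment for the one of order 1 + eps. *)
Lemma sqr_norm_clip_le i z eps : 0 <= i -> 0 < eps <= 1 ->
  (clip i z * i) ^+ 2 <= (`|z| * i) `^ (1 + eps).
Proof.
move=> i0 /andP[e0 e1]; rewrite -real_normK ?num_real// normrM (ger0_norm i0).
rewrite norm_clip//; have zi0 : 0 <= `|z| * i by rewrite mulr_ge0.
have [zi|zi] := leP (`|z| * i) 1.
  rewrite -powR_mulrn//; have [->|n0] := eqVneq (`|z| * i) 0.
    by rewrite !powR0// gt_eqF//; lra.
  by rewrite ger_powR ?lt_neqAle 1?eq_sym ?n0 ?zi0//; lra.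
rewrite expr1n -[leLHS](powRr0 (`|z| * i)) ler_powR ?ltW//; lra.
Qed.

(** The clipping bias: zero for r = |z| i <= 1, and otherwise at most r <= r^(1 + eps). *)
Lemma clip_err i z eps : 0 <= i -> 0 < eps <= 1 ->
  `|clip i z - z| * i <= (`|z| * i) `^ (1 + eps).
Proof.
move=> i0 /andP[e0 e1]; have zi0 : 0 <= `|z| * i by rewrite mulr_ge0.
have [zi|zi] := leP (`|z| * i) 1.
  by rewrite clip_id// subrr normr0 mul0r powR_ge0.
apply: (@le_trans _ _ (`|z| * i)); last first.
  by rewrite -[leLHS]powRr1// ler_powR ?ltW//; lra.
rewrite ler_wpM2r// /clip max_r ?(ltW zi)// -[X in _ - X]mulr1 -mulrBr normrM.
rewrite ler_piMr// ler_norml.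
have : 0 < (`|z| * i)^-1 < 1 by rewrite invr_gt0 (lt_trans ltr01 zi) invf_lt1 ?(lt_trans ltr01 zi).
by move=> /andP[? ?]; apply/andP; split; lra.
Qed.

(* clip i z is the projection of z on the interval `|y| * i <= 1. *)
Lemma clip_proj i z y : 0 <= i -> `|y| * i <= 1 ->
  0 <= (clip i z - y) * (z - clip i z).
Proof.
move=> i0 yi; have [zi|zi] := leP (`|z| * i) 1.
  by rewrite clip_id// subrr mulr0.
have z0 : z != 0 by apply: contraTneq zi => ->; rewrite normr0 mul0r ltr10.
have {}i0 : 0 < i.
  by rewrite lt_neqAle i0 andbT; apply: contraTneq zi => <-; rewrite mulr0 ltr10.
rewrite clip_sat//; set m := `|z| * i in zi.
have m0 : 0 < m by rewrite (lt_trans ltr01).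
have -> : z - Num.sg z / i = z * (1 - m^-1).
  rewrite {1 3}[z]numEsg /m; field.
  by rewrite gt_eqF//= normr_eq0.
rewrite mulrA mulr_ge0//; last by rewrite subr_ge0 invf_le1// ltW.
have -> : (Num.sg z / i - y) * z = Num.sg z * z / i - y * z.
  by rewrite mulrBl mulrAC.
rewrite -normrEsg subr_ge0 (le_trans (ler_norm _))// normrM mulrC.
by rewrite ler_wpM2l// -[leRHS]mul1r ler_pdivlMr.
Qed.

(** Adding the two variational inequalities of the projection even gives the lower bound (clip x -
    clip y)^2. *)
Lemma clip_monotone i x y : 0 <= i -> 0 <= (clip i x - clip i y) * (x - y).
Proof.
move=> i0; have h1 := clip_proj x i0 (norm_clip_le1 y i0).
have h2 := clip_proj y i0 (norm_clip_le1 x i0).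
by have := sqr_ge0 (clip i x - clip i y); lra.
Qed.

Definition clip_level i : \bar R := if i == 0 then +oo%E else (i^-1)%:E.

(** Variational form of the loss: it is the maximum of c z - c^2 / 2 over |c| i <= 1, attained at
    the projection. One formula serves both branches and the level +oo. *)
Lemma huber_clip i z : 0 <= i ->
  huber (clip_level i) z = clip i z * z - clip i z ^+ 2 / 2.
Proof.
move=> i0; rewrite /huber /clip_level; have [->|i0'] := eqVneq i 0.
  rewrite leey /clip mulr0 max_l// divr1; by field.
have {i0'}i0 : 0 < i by rewrite lt_neqAle eq_sym i0'.
rewrite lee_fin -[i^-1]mul1r ler_pdivlMr// mul1r.
have [zi|zi] := leP (`|z| * i) 1; first by rewrite clip_id//; field.
rewrite clip_sat//= [in X in _ = _ * X - _](numEsg z) exprMn.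
have z0 : z != 0 by apply: contraTneq zi => ->; rewrite normr0 mul0r ltr10.
have s2 : Num.sg z ^+ 2 = 1 by rewrite sqr_sg z0.
have -> : Num.sg z / i * (Num.sg z * `|z|) = Num.sg z ^+ 2 * (i^-1 * `|z|) by ring.
by rewrite s2 !mul1r.
Qed.

(** The loss has the 1-Lipschitz derivative [clip]. By [huber_clip] the two sides differ by (c - c')
    (z - c) + (c - c' + h)^2 / 2, whose first term is nonnegative since c is the projection of z. *)
Lemma huber_smooth i z h : 0 <= i ->
  huber (clip_level i) (z + h)
    <= huber (clip_level i) z + clip i z * h + h ^+ 2 / 2.
Proof.
move=> i0; rewrite !huber_clip//.
set c := clip i z; set c' := clip i (z + h).
have h1 : 0 <= (c - c') * (z - c) by rewrite clip_proj// norm_clip_le1.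
by have := sqr_ge0 (c - c' + h); lra.
Qed.

End Clip.

(** * Quadratic forms and determinants *)

Section Quadratic.
Context {R : realType} {d : nat}.
Implicit Types (A H K : 'M[R]_d) (x y z u : 'cV[R]_d) (a : R).

Lemma dotvE x y : dotv x y = \sum_i x i 0 * y i 0.
Proof. by rewrite /dotv mxE; apply: eq_bigr => i _; rewrite mxE. Qed.

Lemma dotvC x y : dotv x y = dotv y x.
Proof. by rewrite !dotvE; apply: eq_bigr => i _; rewrite mulrC. Qed.

Lemma dotvDr x y z : dotv x (y + z) = dotv x y + dotv x z.
Proof. by rewrite /dotv mulmxDr mxE. Qed.

Lemma dotvDl x y z : dotv (x + y) z = dotv x z + dotv y z.
Proof. by rewrite !(dotvC _ z) dotvDr. Qed.

Lemma dotvZr a x y : dotv x (a *: y) = a * dotv x y.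
Proof. by rewrite /dotv -scalemxAr mxE. Qed.

Lemma dotvZl a x y : dotv (a *: x) y = a * dotv x y.
Proof. by rewrite dotvC dotvZr dotvC. Qed.

Lemma dotvNr x y : dotv x (- y) = - dotv x y.
Proof. by rewrite -scaleN1r dotvZr mulN1r. Qed.

Lemma dotvNl x y : dotv (- x) y = - dotv x y.
Proof. by rewrite dotvC dotvNr dotvC. Qed.

Lemma dotv0r x : dotv x 0 = 0.
Proof. by rewrite -(scale0r 0) dotvZr mul0r. Qed.

Lemma dotv0l x : dotv 0 x = 0.
Proof. by rewrite dotvC dotv0r. Qed.

Lemma dotv_sumr (I : Type) (r : seq I) (Q : pred I) x (F : I -> 'cV[R]_d) :
  dotv x (\sum_(i <- r | Q i) F i) = \sum_(i <- r | Q i) dotv x (F i).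
Proof. exact: (big_morph _ (dotvDr x) (dotv0r x)). Qed.

Lemma dotvv_ge0 x : 0 <= dotv x x.
Proof. by rewrite dotvE sumr_ge0// => i _; rewrite -expr2 sqr_ge0. Qed.

Lemma dotvv_eq0 x : (dotv x x == 0) = (x == 0).
Proof.
rewrite dotvE psumr_eq0; last by move=> i _; rewrite -expr2 sqr_ge0.
apply/allP/eqP => [h|-> i _]; last by rewrite mxE mulr0 eqxx.
apply/matrixP => i j; rewrite ord1 mxE; apply/eqP.
by have /= := h i (mem_index_enum i); rewrite -expr2 sqrf_eq0.
Qed.

Lemma dotv_mul_tr A x y : dotv x (A *m y) = dotv (A^T *m x) y.
Proof. by rewrite /dotv trmx_mul trmxK mulmxA. Qed.

Definition rank1 x : 'M[R]_d := x *m x^T.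

Lemma rank1_mul x y : rank1 x *m y = dotv x y *: x.
Proof.
rewrite /rank1 -mulmxA [x^T *m y]mx11_scalar -/(dotv x y).
by rewrite mul_mx_scalar.
Qed.

Lemma rank1_tr x : (rank1 x)^T = rank1 x.
Proof. by rewrite /rank1 trmx_mul trmxK. Qed.

Lemma rank1Z a x : rank1 (a *: x) = a ^+ 2 *: rank1 x.
Proof. by rewrite /rank1 linearZ/= -scalemxAl -scalemxAr scalerA expr2. Qed.

Lemma sqr_norm2 x : norm2 x ^+ 2 = dotv x x.
Proof. by rewrite sqr_sqrtr// dotvv_ge0. Qed.

Lemma cauchy_schwarz A x y : A^T = A -> (forall z, 0 <= dotv z (A *m z)) ->
  dotv x (A *m y) ^+ 2 <= dotv x (A *m x) * dotv y (A *m y).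
Proof.
move=> AT A0.
set a := dotv x (A *m x); set b := dotv y (A *m y); set c := dotv x (A *m y).
have cC : dotv y (A *m x) = c by rewrite /c dotv_mul_tr AT dotvC.
have q s t : 0 <= s ^+ 2 * a + 2 * (s * t) * c + t ^+ 2 * b.
  have := A0 (s *: x + t *: y).
  rewrite mulmxDr -!scalemxAr !(dotvDl, dotvDr, dotvZl, dotvZr) cC -/a -/b -/c.
  by congr (0 <= _); ring.
have a0 : 0 <= a := A0 x.
(* If a = 0, the form at t = 1 is affine in s, and the s below gives it the value -1 unless c = 0.
   If a > 0, s = - c minimizes it at t = a. *)
have [a00|an0] := eqVneq a 0.
  have [->|cn0] := eqVneq c 0; first by rewrite expr0n/= mulr_ge0// A0.
  have := q (- (b + 1) / (2 * c)) 1; rewrite a00.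
  have -> : (- (b + 1) / (2 * c)) ^+ 2 * 0 + 2 * (- (b + 1) / (2 * c) * 1) * c
      + 1 ^+ 2 * b = - 1 by field.
  by rewrite lerNr oppr0 ler10.
have {an0}a1 : 0 < a by rewrite lt_neqAle eq_sym an0.
have := q (- c) a; rewrite -(ler_pM2l a1).
have -> : (- c) ^+ 2 * a + 2 * (- c * a) * c + a ^+ 2 * b =
  a * (a * b - c ^+ 2) by ring.
by rewrite ler_pM2l// pmulr_rge0// subr_ge0.
Qed.

Lemma mnorm_ge0 A x : 0 <= mnorm A x.
Proof. exact: sqrtr_ge0. Qed.

Lemma sqr_mnorm A x : 0 <= dotv x (A *m x) ->
  mnorm A x ^+ 2 = dotv x (A *m x).
Proof. exact: sqr_sqrtr. Qed.

Lemma mnormZ A a x : mnorm A (a *: x) = `|a| * mnorm A x.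
Proof.
rewrite /mnorm -scalemxAr dotvZl dotvZr mulrA -expr2 sqrtrM ?sqr_ge0//.
by rewrite sqrtr_sqr.
Qed.

(** Duality of the norms of H and H^-1: since x = H (K x), this is Cauchy-Schwarz for the form H
    between K x and y. *)
Lemma dotv_le_mnorm H K x y : K *m H = 1%:M -> H^T = H -> K^T = K ->
  (forall z, 0 <= dotv z (H *m z)) ->
  dotv x y <= mnorm K x * mnorm H y.
Proof.
move=> KH HT KT H0.
have HK : H *m K = 1%:M by rewrite -HT -KT -trmx_mul KH trmx1.
have eK z : dotv z (K *m z) = dotv (K *m z) (H *m (K *m z)).
  by rewrite mulmxA HK mul1mx dotvC.
have -> : dotv x y = dotv (K *m x) (H *m y).
  by rewrite dotv_mul_tr HT mulmxA HK mul1mx.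
rewrite (le_trans (ler_norm _))// -sqrtr_sqr -sqrtrM ?eK//.
by rewrite ler_wsqrtr// cauchy_schwarz.
Qed.

Lemma inverse_quad_ge0 (A C : 'M[R]_d) x : C *m A = 1%:M -> A^T = A ->
  C^T = C -> (forall x, 0 <= dotv x (A *m x)) -> 0 <= dotv x (C *m x).
Proof.
move=> CA AT CT A0; have AC : A *m C = 1%:M by rewrite -AT -CT -trmx_mul CA trmx1.
by have := A0 (C *m x); rewrite mulmxA AC mul1mx dotvC.
Qed.

(* The Sherman-Morrison formula for the inverse of H + u u^T, where K = H^-1. *)
Definition inv_update K u : 'M[R]_d :=
  K - (1 + dotv u (K *m u))^-1 *: rank1 (K *m u).

Lemma inv_updateP H K u : K *m H = 1%:M -> K^T = K -> H^T = H ->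
  1 + dotv u (K *m u) != 0 ->
  inv_update K u *m (H + rank1 u) = 1%:M.
Proof.
move=> KH KT HT n0; rewrite /inv_update mulmxBl mulmxDr KH.
set q := dotv u (K *m u) in n0 *.
have e1 : K *m rank1 u = (K *m u) *m u^T by rewrite /rank1 mulmxA.
have e2 : rank1 (K *m u) *m H = (K *m u) *m u^T.
  by rewrite /rank1 trmx_mul KT -!mulmxA KH mulmx1.
have e3 : rank1 (K *m u) *m rank1 u = q *: ((K *m u) *m u^T).
  rewrite {2}/rank1 mulmxA rank1_mul dotvC -/q.
  by rewrite -scalemxAl.
rewrite -scalemxAl mulmxDr e1 e2 e3 -[X in _ *: (X + _)]scale1r -scalerDl.
by rewrite scalerA mulVf// scale1r addrK.
Qed.

Lemma inv_update_tr K u : K^T = K -> (inv_update K u)^T = inv_update K u.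
Proof. by move=> KT; rewrite /inv_update linearB/= linearZ/= rank1_tr KT. Qed.

Lemma inv_update_quad K u x : K^T = K ->
  dotv x (inv_update K u *m x)
  = dotv x (K *m x) - dotv u (K *m x) ^+ 2 / (1 + dotv u (K *m u)).
Proof.
move=> KT; rewrite /inv_update mulmxBl -scalemxAl rank1_mul.
rewrite dotvDr dotvNr !dotvZr.
have -> : dotv (K *m u) x = dotv u (K *m x) by rewrite dotv_mul_tr KT.
have -> : dotv x (K *m u) = dotv u (K *m x) by rewrite dotv_mul_tr KT dotvC.
by rewrite mulrC expr2.
Qed.

Lemma quad_addl H u x :
  dotv x ((H + rank1 u) *m x) = dotv x (H *m x) + dotv u x ^+ 2.
Proof.
by rewrite mulmxDl dotvDr rank1_mul dotvZr [dotv x u]dotvC expr2.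
Qed.

(* det (1 + a b^T) = 1 + b^T a, by two factorizations of the block matrix
   [[1, - b^T], [a, 1]]. *)
Lemma det_add_rank1 x y : \det (1%:M + x *m y^T) = 1 + dotv y x.
Proof.
pose M := block_mx 1%:M (- y^T) x (1%:M : 'M[R]_d).
have d1 : \det M = \det (1%:M + x *m y^T).
  have -> : M = block_mx 1%:M 0 x 1%:M
                *m block_mx 1%:M (- y^T) 0 (1%:M + x *m y^T).
    rewrite mulmx_block !mul1mx !mul0mx !mulmx1 !addr0 /M.
    by rewrite mulmxN addrCA addNr addr0.
  by rewrite det_mulmx det_lblock det_ublock !det1 !mul1r.
have d2 : \det M = 1 + dotv y x.
  have -> : M = block_mx (1%:M + y^T *m x) (- y^T) 0 1%:M
                *m block_mx 1%:M 0 x 1%:M.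
    rewrite mulmx_block !mul1mx !mul0mx !mulmx1 !mulmx0 !add0r /M.
    by rewrite mulNmx addrK.
  rewrite det_mulmx det_lblock det_ublock !det1 !mulr1.
  by rewrite [_ + _]mx11_scalar det_scalar1 mxE mxE eqxx.
by rewrite -d1.
Qed.

Lemma det_update H K u : K *m H = 1%:M -> H^T = H -> K^T = K ->
  \det (H + rank1 u) = \det H * (1 + dotv u (K *m u)).
Proof.
move=> KH HT KT; have HK : H *m K = 1%:M by rewrite -HT -KT -trmx_mul KH trmx1.
rewrite -det_add_rank1 -det_mulmx; congr (\det _).
by rewrite mulmxDr mulmx1 !mulmxA HK mul1mx.
Qed.

End Quadratic.

(** * Hadamard's inequality and the determinant-trace bound *)

Lemma dotv_col (R : realType) (m n : nat) (x y : 'cV[R]_m) (z t : 'cV[R]_n) :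
  dotv (col_mx x z) (col_mx y t) = dotv x y + dotv z t.
Proof. by rewrite /dotv tr_col_mx mul_row_col mxE. Qed.

(** Induction through the Schur complement s of the lower block C: det A = s det C with 0 < s <= a,
    where a is the corner entry. *)
Lemma hadamard (R : realType) (n : nat) (A : 'M[R]_n) : A^T = A ->
  (forall x, x != 0 -> 0 < dotv x (A *m x)) ->
  0 < \det A <= \prod_i A i i.
Proof.
elim: n A => [|n IH] A AT A0; first by rewrite det_mx00 big_ord0 ltr01 lexx.
rewrite -[n.+1]/(1 + n)%N in A AT A0 *.
pose a := A 0 0; pose v := dlsubmx A; pose C := drsubmx A.
have AE : A = block_mx a%:M v^T v C.
  rewrite -[LHS]submxK -/v -/C; congr block_mx.
    by rewrite [LHS]mx11_scalar /a; congr (_%:M); rewrite !mxE !lshift0.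
  by rewrite /v trmx_dlsub AT.
have CT : C^T = C by rewrite /C trmx_drsub AT.
have quadA s x : dotv (col_mx s%:M x) (A *m col_mx s%:M x)
    = s ^+ 2 * a + 2 * s * dotv v x + dotv x (C *m x).
  rewrite AE mul_block_col dotv_col dotvDr mul_mx_scalar dotvZr.
  have dot1 (z : 'cV[R]_1) : dotv s%:M z = s * z 0 0.
    by rewrite dotvE big_ord1 mxE eqxx.
  rewrite !dot1 [a%:M _ _]mxE eqxx mulr1n -/(dotv v x) dotvDr.
  rewrite mul_mx_scalar dotvZr (dotvC x v).
  by ring.
have C0 x : x != 0 -> 0 < dotv x (C *m x).
  move=> xn0; have := quadA 0 x.
  rewrite expr0n/= !mul0r mulr0 mul0r !add0r => <-; apply: A0.
  apply: contra_neq xn0 => h; have := congr1 dsubmx h.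
  by rewrite col_mxKd => ->; apply/matrixP => i j; rewrite !mxE.
have /andP[dC0 dCle] := IH C CT C0.
have Cu : C \in unitmx by rewrite unitmxE unitfE gt_eqF.
pose D := invmx C.
have DC : D *m C = 1%:M by rewrite mulVmx.
have CD : C *m D = 1%:M by rewrite mulmxV.
pose s := a - dotv v (D *m v).
have detA : \det A = s * \det C.
  have e : A *m block_mx 1%:M 0 (- (D *m v)) 1%:M = block_mx s%:M v^T 0 C.
    rewrite AE mulmx_block !mulmx1 !mulmx0 !add0r; congr block_mx.
      by rewrite mulmxN [v^T *m _]mx11_scalar -/(dotv v _) -raddfB.
    by rewrite mulmxN mulmxA CD mul1mx subrr.
  have := congr1 determinant e.
  rewrite det_mulmx det_lblock det_ublock !det1 !mulr1 det_scalar1.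
  by [].
have s0 : 0 < s.
  (* The form takes the value s at the vector (1, - C^-1 v). *)
  have := quadA 1 (- (D *m v)); rewrite expr1n mul1r mulr1 mulmxN mulmxA CD mul1mx.
  rewrite !dotvNr dotvNl opprK [dotv (D *m v) v]dotvC => e.
  have -> : s = a + 2 * - dotv v (D *m v) + dotv v (D *m v) by rewrite /s; ring.
  rewrite -e; apply: A0; apply: contra_neq (oner_neq0 R) => h.
  by have := congr1 (fun M => usubmx M 0 0) h; rewrite col_mxKu !mxE eqxx.
have sa : s <= a.
  rewrite /s lerBlDl lerDr; have [->|vn0] := eqVneq v 0; first by rewrite dotv0l.
  have := C0 (D *m v); rewrite mulmxA CD mul1mx dotvC => h.
  apply/ltW/h; apply: contra_neq vn0 => h'.
  by rewrite -[v]mul1mx -CD -mulmxA h' mulmx0.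
rewrite detA mulr_gt0//= big_ord_recl.
have -> : \prod_(i < n) A (lift ord0 i) (lift ord0 i) = \prod_(i < n) C i i.
  by apply: eq_bigr => i _; rewrite /C !mxE; congr (A _ _); apply: val_inj.
by rewrite ler_pM// ltW.
Qed.

(** AM-GM on the diagonal entries after Hadamard, which avoids eigenvalues. *)
Lemma det_le_trace (R : realType) (n : nat) (A : 'M[R]_n) : A^T = A ->
  (forall x, x != 0 -> 0 < dotv x (A *m x)) ->
  0 < \det A <= (\tr A / n%:R) ^+ n.
Proof.
move=> AT A0; have /andP[-> h] := hadamard AT A0; rewrite (le_trans h)//.
have Aii i : 0 <= A i i.
  have : delta_mx i 0 != 0 :> 'cV[R]_n.
    by apply: contra_neq (oner_neq0 R) => /matrixP/(_ i 0); rewrite !mxE !eqxx.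
  move/A0; rewrite /dotv trmx_delta -rowE -colE !mxE => /ltW.
  by [].
have := @leif_AGM R _ 'I_n (fun i => A i i) (fun i _ => Aii i).
rewrite card_ord => /leifP.
rewrite -/(\tr A).
by rewrite /mxtrace; case: ifP => _ => [/eqP ->|/ltW].
Qed.

(** * Analysis of one trajectory *)

Section Trajectory.
Context {R : realType} {d : nat}.
Variables (p : ahr_params R) (nuhat : nat -> R) (phi : nat -> 'cV[R]_d).
Variable noise : nat -> R.

Local Notation T := (ahr_T p).
Local Notation eps := (ahr_eps p).
Local Notation L := (ahr_L p).
Local Notation B := (ahr_B p).
Local Notation lambda := (ahr_lambda p).
Local Notation smin := (ahr_sigma_min p).
Local Notation c0 := (ahr_c0 p).
Local Notation c1 := (ahr_c1 p).
Local Notation tau0 := (ahr_tau0 p).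
Local Notation b := (ahr_b p).
Local Notation kappa := (ahr_kappa (d := d) p).
Local Notation H := (ahr_H p nuhat phi).
Local Notation sigma := (ahr_sigma p nuhat phi).
Local Notation w := (ahr_w p nuhat phi).

Definition ahr_u (t : nat) : 'cV[R]_d := (sigma t)^-1 *: phi t.
Local Notation u := ahr_u.

(* The inverse of H_t, by a recursion that makes it visibly measurable. *)
Fixpoint ahr_K (t : nat) : 'M[R]_d :=
  match t with
  | 0 => lambda^-1%:M
  | s.+1 => inv_update (ahr_K s) (u s.+1)
  end.
Local Notation K := ahr_K.

(** By Sherman-Morrison this is the leverage u_t^T H_t^-1 u_t, taken with the updated matrix. *)
Definition ahr_v (t : nat) : R := w t ^+ 2 / (1 + w t ^+ 2).
Local Notation v := ahr_v.

(* 1 / tau_t, which is 0 when tau_t = +oo *)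
Definition ahr_itau (t : nat) : R :=
  Num.sqrt (v t) / (tau0 * t%:R `^ ((1 - eps) / (2 * (1 + eps)))).
Local Notation itau := ahr_itau.

Definition ahr_z (t : nat) : R := noise t / sigma t.
Local Notation z := ahr_z.

Definition ahr_psi (t : nat) : R := clip (itau t) (z t).
Local Notation psi := ahr_psi.

Definition ahr_S (t : nat) : 'cV[R]_d := \sum_(1 <= s < t.+1) psi s *: u s.
Local Notation S := ahr_S.

Definition ahr_Z (t : nat) : R := mnorm (K t) (S t).
Local Notation Z := ahr_Z.

Definition ahr_g (t : nat) : R := dotv (u t) (K t.-1 *m S t.-1).
Local Notation g := ahr_g.

Lemma ahr_v_ge0 t : 0 <= v t.
Proof. by rewrite divr_ge0 ?addr_ge0 ?sqr_ge0. Qed.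

Lemma ahr_v_le_sqr t : v t <= w t ^+ 2.
Proof.
have := sqr_ge0 (w t); rewrite /ahr_v => w0.
by rewrite ler_pdivrMr; [rewrite ler_peMr//; lra | lra].
Qed.

Lemma ahr_w_ge0 t : 0 <= w t. Proof. exact: sqrtr_ge0. Qed.

Lemma ahr_add1_sqr_w_gt0 t : 0 < 1 + w t ^+ 2.
Proof. by rewrite ltr_pwDl// sqr_ge0. Qed.

Lemma ahr_HS t : H t.+1 = H t + rank1 (u t.+1).
Proof. by rewrite rank1Z /= exprVn. Qed.

Lemma ahr_H_tr t : (H t)^T = H t.
Proof.
elim: t => [|t IH]; first by rewrite tr_scalar_mx.
by rewrite ahr_HS linearD/= rank1_tr IH.
Qed.

Lemma ahr_K_tr t : (K t)^T = K t.
Proof.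
by elim: t => [|t IH]; [rewrite tr_scalar_mx | rewrite inv_update_tr].
Qed.

Lemma ahr_H_quad t x : dotv x (H t *m x)
  = lambda * dotv x x + \sum_(1 <= s < t.+1) dotv (u s) x ^+ 2.
Proof.
elim: t => [|t IH]; first by rewrite big_geq// addr0 mul_scalar_mx dotvZr.
by rewrite ahr_HS quad_addl IH (big_nat_recr t.+1)//= addrA.
Qed.

Hypothesis lambda_gt0 : 0 < lambda.

Lemma ahr_H_ge t x : lambda * dotv x x <= dotv x (H t *m x).
Proof. by rewrite ahr_H_quad lerDl sumr_ge0// => s _; rewrite sqr_ge0. Qed.

Lemma ahr_H_ge0 t x : 0 <= dotv x (H t *m x).
Proof.
by rewrite (le_trans _ (ahr_H_ge t x))// mulr_ge0 ?dotvv_ge0// ltW.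
Qed.

Lemma ahr_H_gt0 t x : x != 0 -> 0 < dotv x (H t *m x).
Proof.
move=> x0; rewrite (lt_le_trans _ (ahr_H_ge t x))// mulr_gt0//.
by rewrite lt_neqAle dotvv_ge0 eq_sym dotvv_eq0 x0.
Qed.

Lemma ahr_KH t : K t *m H t = 1%:M.
Proof.
elim: t => [|t IH].
  by rewrite /= -scalar_mxM mulVf// gt_eqF.
rewrite ahr_HS inv_updateP ?ahr_K_tr ?ahr_H_tr// gt_eqF// ltr_pwDl//.
exact: (inverse_quad_ge0 _ IH (ahr_H_tr t) (ahr_K_tr t) (ahr_H_ge0 t)).
Qed.

Lemma ahr_K_ge0 t x : 0 <= dotv x (K t *m x).
Proof.
exact: (inverse_quad_ge0 _ (ahr_KH t) (ahr_H_tr t) (ahr_K_tr t) (ahr_H_ge0 t)).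
Qed.

Lemma invmx_ahr_H t : invmx (H t) = K t.
Proof.
have Hu : H t \in unitmx by case: (mulmx1_unit (ahr_KH t)).
by rewrite -[invmx _]mul1mx -(ahr_KH t) -mulmxA mulmxV// mulmx1.
Qed.

Lemma sqr_ahr_w t : w t ^+ 2 = dotv (u t) (K t.-1 *m u t).
Proof. by rewrite /ahr_w invmx_ahr_H sqr_mnorm// ahr_K_ge0. Qed.

Lemma ahr_K_quad_le s t x : (s <= t)%N ->
  dotv x (K t *m x) <= dotv x (K s *m x).
Proof.
elim: t => [|t IH]; first by rewrite leqn0 => /eqP ->.
rewrite leq_eqVlt => /predU1P[->//|]; rewrite ltnS => /IH; apply: le_trans.
rewrite /= inv_update_quad ?ahr_K_tr// gerBl mulr_ge0 ?sqr_ge0// invr_ge0.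
by rewrite addr_ge0 ?ahr_K_ge0.
Qed.

(** The inverses decrease in t, and at t = s the form is exactly [v s]. By duality this bounds the
    square of u_s^T x by v_s times the squared H_t-norm of x. *)
Lemma ahr_u_K_le s t : (1 <= s <= t)%N -> dotv (u s) (K t *m u s) <= v s.
Proof.
case: s => // s /= st; rewrite (le_trans (ahr_K_quad_le _ st))//=.
rewrite inv_update_quad ?ahr_K_tr//.
rewrite /ahr_v sqr_ahr_w/=; set q := dotv _ _.
have q0 : 0 <= q by rewrite ahr_K_ge0.
by rewrite le_eqVlt; apply/orP; left; apply/eqP; field; rewrite gt_eqF// ltr_pwDl.
Qed.

Lemma det_ahr_H t :
  \det (H t) = lambda ^+ d * \prod_(1 <= s < t.+1) (1 + w s ^+ 2).
Proof.
elim: t => [|t IH]; first by rewrite big_geq// mulr1 det_scalar.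
by rewrite ahr_HS (det_update _ (ahr_KH t)) ?ahr_H_tr ?ahr_K_tr// IH
  (big_nat_recr t.+1)//= sqr_ahr_w mulrA.
Qed.

Hypothesis smin_gt0 : 0 < smin.

Lemma ahr_sigma_ge t : smin <= sigma t.
Proof. by rewrite /ahr_sigma /ahr_sigma_step/= !le_max lexx orbT. Qed.

Lemma ahr_sigma_gt0 t : 0 < sigma t.
Proof. exact: lt_le_trans smin_gt0 (ahr_sigma_ge t). Qed.

Lemma ahr_sigma_nuhat t : nuhat t <= sigma t.
Proof. by rewrite /ahr_sigma /ahr_sigma_step/= !le_max lexx. Qed.

Lemma ahr_wE t : w t = mnorm (K t.-1) (phi t) / sigma t.
Proof.
rewrite /ahr_w invmx_ahr_H mnormZ ger0_norm ?invr_ge0 ?(ltW (ahr_sigma_gt0 _))//.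
by rewrite mulrC.
Qed.

Lemma ahr_w_le t : 0 < c0 -> w t <= c0.
Proof.
move=> c00; rewrite ahr_wE ler_pdivrMr ?ahr_sigma_gt0// mulrC -ler_pdivrMr//.
by rewrite /ahr_sigma /ahr_sigma_step/= invmx_ahr_H !le_max lexx !orbT.
Qed.

Lemma ahr_v_le t : 0 < c0 -> v t <= c0 ^+ 2.
Proof.
move=> c00; rewrite (le_trans (ahr_v_le_sqr t))//.
by rewrite lerXn2r ?nnegrE ?ahr_w_ge0 ?ahr_w_le// ltW.
Qed.

(** The square of the fourth entry of the maximum defining sigma. With |phi| in the H^-1 norm
    written as w sigma, one factor sigma cancels; the quarter powers become one square root. *)
Lemma ahr_sigma_LB t : 0 < L -> 0 < B -> 0 < c1 -> 0 < kappa -> 0 < b ->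
  L * B * w t <= Num.sqrt (c1 * (2 * kappa * b ^+ 2)) * sigma t.
Proof.
move=> L0 B0 c10 k0 b0.
set D := 2 * kappa * b ^+ 2.
have D0 : 0 < D by rewrite mulr_gt0 ?exprn_gt0// mulr_gt0.
set q := c1 `^ 4^-1 * D `^ 4^-1.
have q0 : 0 < q by rewrite mulr_gt0// powR_gt0.
have q2 : q ^+ 2 = Num.sqrt (c1 * D).
  have -> : Num.sqrt (c1 * D) = (c1 * D) `^ 2^-1.
    by rewrite powR12_sqrt// mulr_ge0// ltW.
  rewrite powRM ?(ltW c10) ?(ltW D0)// /q exprMn.
  rewrite -!powR_mulrn ?powR_ge0// -!powRrM.
  by congr (_ `^ _ * _ `^ _); field.
have s0 := ahr_sigma_gt0 t.
set r := mnorm (K t.-1) (phi t).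
have r0 : 0 <= r by exact: mnorm_ge0.
have : Num.sqrt (L * B) / q * Num.sqrt r <= sigma t.
  by rewrite /ahr_sigma /ahr_sigma_step/= invmx_ahr_H !le_max lexx !orbT.
rewrite mulrAC ler_pdivrMr// -sqrtrM ?mulr_ge0 ?(ltW L0) ?(ltW B0)// => h.
have : L * B * r <= (sigma t * q) ^+ 2.
  rewrite -[leLHS]sqr_sqrtr ?mulr_ge0 ?(ltW L0) ?(ltW B0)//.
  apply: lerXn2r => //; rewrite nnegrE ?sqrtr_ge0// mulr_ge0 ?(ltW s0)//.
  exact: ltW.
rewrite exprMn q2 => h2.
rewrite ahr_wE -/r mulrA ler_pdivrMr// (le_trans h2)//.
by rewrite expr2 mulrC mulrA.
Qed.

(** Elliptical potential: v <= ln (1 + w^2), the product of the 1 + w^2 is det H_T / lambda^d by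
    [det_ahr_H], and the trace of H_T controls the determinant. *)
Lemma ahr_potential : (1 <= d)%N ->
  (forall s, (1 <= s <= T)%N -> norm2 (phi s) <= L) ->
  \sum_(1 <= s < T.+1) v s <= kappa.
Proof.
move=> d1 phiL.
have d0 : 0 < d%:R :> R by rewrite ltr0n.
have /andP[det0 detle] := det_le_trace (ahr_H_tr T) (@ahr_H_gt0 T).
have trle : \tr (H T) <= d%:R * lambda + T%:R * L ^+ 2 / smin ^+ 2.
  have trE t : \tr (H t) = d%:R * lambda
      + \sum_(1 <= s < t.+1) dotv (u s) (u s).
    elim: t => [|t IH]; first by rewrite big_geq// addr0 mxtrace_scalar mulr_natl.
    rewrite ahr_HS raddfD/= IH (big_nat_recr t.+1)//= addrA; congr (_ + _).
    by rewrite /rank1 mxtrace_mulC /dotv /mxtrace big_ord1.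
  rewrite trE lerD2l -mulrA mulr_natl.
  rewrite (le_trans (y := \sum_(1 <= s < T.+1) (L ^+ 2 / smin ^+ 2)))//; last first.
    by rewrite sumr_const_nat subn1.
  apply: ler_sum_nat => s /andP[s1 sT]; rewrite /ahr_u dotvZl dotvZr mulrA -expr2.
  have sT' : (1 <= s <= T)%N by rewrite s1 -ltnS.
  rewrite mulrC ler_pM ?dotvv_ge0 ?sqr_ge0//.
    by rewrite -sqr_norm2 lerXn2r ?nnegrE ?sqrtr_ge0 ?(le_trans _ (phiL _ sT')) ?sqrtr_ge0 ?phiL.
  rewrite exprVn lef_pV2 ?posrE ?exprn_gt0 ?ahr_sigma_gt0//.
  by rewrite lerXn2r ?nnegrE ?ahr_sigma_ge ?(ltW smin_gt0) ?(ltW (ahr_sigma_gt0 _)).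
have X0 : 0 <= T%:R * L ^+ 2 / (d%:R * lambda * smin ^+ 2).
  apply: divr_ge0; first by apply: mulr_ge0 => //; exact: sqr_ge0.
  by apply: mulr_ge0; [apply: mulr_ge0 => //; exact: ltW | exact: sqr_ge0].
have prod_le : \prod_(1 <= s < T.+1) (1 + w s ^+ 2)
    <= (1 + T%:R * L ^+ 2 / (d%:R * lambda * smin ^+ 2)) ^+ d.
  rewrite -(ler_pM2l (exprn_gt0 d lambda_gt0)) -det_ahr_H (le_trans detle)//.
  rewrite -exprMn; apply: lerXn2r; rewrite ?nnegrE.
  - rewrite divr_ge0 ?(ltW d0)// /mxtrace sumr_ge0// => i _.
    have : delta_mx i 0 != 0 :> 'cV[R]_d.
      by apply: contra_neq (oner_neq0 R) => /matrixP/(_ i 0); rewrite !mxE !eqxx.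
    by move/(@ahr_H_gt0 T); rewrite /dotv trmx_delta -rowE -colE !mxE => /ltW.
  - by rewrite mulr_ge0 ?(ltW lambda_gt0)// addr_ge0.
  - rewrite ler_pdivrMr// (le_trans trle)// le_eqVlt; apply/orP; left; apply/eqP.
    by field; rewrite !gt_eqF.
rewrite (le_trans (y := ln (\prod_(1 <= s < T.+1) (1 + w s ^+ 2))))//; last first.
  rewrite /ahr_kappa mulr_natl -lnXn ?ler_ln ?posrE//.
  - by apply: prodr_gt0 => s _; rewrite ahr_add1_sqr_w_gt0.
  - by rewrite exprn_gt0// ltr_pwDl.
  - by rewrite ltr_pwDl.
elim: T => [|n IH]; first by rewrite !big_geq// ln1.
rewrite !(big_nat_recr n.+1)//= lnM ?posrE ?ahr_add1_sqr_w_gt0//; last first.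
  by apply: prodr_gt0 => s _; rewrite ahr_add1_sqr_w_gt0.
rewrite lerD// -[X in _ <= ln X]invrK lnV ?posrE ?invr_gt0 ?ahr_add1_sqr_w_gt0//.
have w0 := ahr_add1_sqr_w_gt0 n.+1.
(* As 1 / (1 + w^2) = 1 - v, the claim is ln (1 - v) <= - v. *)
have vE : (1 + w n.+1 ^+ 2)^-1 = 1 + - v n.+1.
  by rewrite /ahr_v; field; rewrite gt_eqF.
rewrite vE lerNr le_ln1Dx// ltrN2 /ahr_v ltr_pdivrMr// mul1r.
by rewrite ltrDr.
Qed.

Hypothesis tau0_gt0 : 0 < tau0.

Lemma ahr_itau_ge0 t : 0 <= itau t.
Proof. by rewrite divr_ge0 ?sqrtr_ge0// mulr_ge0 ?powR_ge0// ltW. Qed.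

Lemma ahr_tauE t : (1 <= t)%N -> ahr_tau p nuhat phi t = clip_level (itau t).
Proof.
move=> t1; rewrite /ahr_tau /clip_level /ahr_itau.
have te0 : 0 < t%:R `^ ((1 - eps) / (2 * (1 + eps))) :> R.
  by rewrite powR_gt0// ltr0n.
rewrite mulf_eq0 invr_eq0 mulf_eq0 !(gt_eqF te0) (gt_eqF tau0_gt0)/= orbF.
have -> : (Num.sqrt (v t) == 0) = (w t == 0).
  rewrite sqrtr_eq0 ler_pdivrMr ?ahr_add1_sqr_w_gt0// mul0r.
  by rewrite -(sqrf_eq0 (w t)) eq_le sqr_ge0 andbT.
have [//|w0] := eqVneq (w t) 0; congr (_%:E).
have sq0 : 0 < Num.sqrt (1 + w t ^+ 2) by rewrite sqrtr_gt0 ahr_add1_sqr_w_gt0.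
have -> : Num.sqrt (v t) = w t / Num.sqrt (1 + w t ^+ 2).
  rewrite /ahr_v sqrtrM ?sqr_ge0// sqrtrV ?(ltW (ahr_add1_sqr_w_gt0 t))//.
  by rewrite sqrtr_sqr ger0_norm ?ahr_w_ge0.
by field; rewrite w0 !gt_eqF.
Qed.

Lemma ahr_Z0 : Z 0 = 0.
Proof. by rewrite /ahr_Z /ahr_S big_geq// /mnorm mulmx0 dotv0r sqrtr0. Qed.

Lemma ahr_Z_step t : Z t.+1 ^+ 2 <= Z t ^+ 2
  + 2 * (psi t.+1 * g t.+1 / (1 + w t.+1 ^+ 2)) + psi t.+1 ^+ 2 * v t.+1.
Proof.
rewrite /ahr_Z (sqr_mnorm (ahr_K_ge0 t.+1 _)) (sqr_mnorm (ahr_K_ge0 t _)).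
rewrite [ahr_K t.+1]/= inv_update_quad ?ahr_K_tr//.
rewrite /ahr_v (sqr_ahr_w t.+1)/= /ahr_g /=.
have -> : S t.+1 = S t + psi t.+1 *: u t.+1 by rewrite /ahr_S big_nat_recr.
move: (u t.+1) (psi t.+1) => U a.
set q := dotv U (K t *m U); set h := dotv U (K t *m S t).
have q0 : 0 <= q by rewrite ahr_K_ge0.
have hE : dotv (S t) (K t *m U) = h by rewrite dotv_mul_tr ahr_K_tr dotvC.
rewrite !mulmxDr -!scalemxAr !(dotvDl, dotvDr, dotvZl, dotvZr) hE -/q -/h.
set N := dotv _ _.
have : 0 <= h ^+ 2 / (1 + q) by rewrite divr_ge0 ?sqr_ge0// addr_ge0.
(* The only loss in the recursion is the dropped term - h^2 / (1 + q). *)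
have -> : N + a * h + a * (h + a * q) - (h + a * q) ^+ 2 / (1 + q)
  = N + 2 * (a * h / (1 + q)) + a ^+ 2 * (q / (1 + q)) - h ^+ 2 / (1 + q).
  by field; rewrite gt_eqF// ltr_pwDl.
by lra.
Qed.

(** Breaks the circularity of the cross terms. By strong induction [Z s.-1] <= [alpha t] for s <= t,
    so every maximum equals [alpha t] and factors out; then Z_t^2 <= 2 alpha_t D_t + Q_t <=
    alpha_t^2. *)
Lemma ahr_Z_bound (alpha D Q : nat -> R) n :
  (forall t, (1 <= t)%N -> 0 < alpha t) ->
  (forall s t, (s <= t)%N -> alpha s <= alpha t) ->
  (forall t, (1 <= t <= n)%N -> 2 * (alpha t * D t) + Q t <= alpha t ^+ 2) ->
  (forall t, (1 <= t <= n)%N ->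
    \sum_(1 <= s < t.+1) psi s * g s
       / ((1 + w s ^+ 2) * Num.max (alpha t) (Z s.-1)) <= D t) ->
  (forall t, (1 <= t <= n)%N ->
    \sum_(1 <= s < t.+1) psi s ^+ 2 * v s <= Q t) ->
  forall t, (1 <= t <= n)%N -> Z t <= alpha t.
Proof.
move=> alpha0 alpha_le hal hD hQ t; elim/ltn_ind: t => t IH /andP[t1 tn].
have t1n : (1 <= t <= n)%N by rewrite t1.
have at0 := alpha0 _ t1.
have Zs s : (s < t)%N -> Z s <= alpha t.
  case: s => [|s] st; first by rewrite ahr_Z0 ltW.
  rewrite (le_trans (IH _ st _)) ?alpha_le ?(ltnW st)//=.
  by rewrite (leq_trans (ltnW st) tn).
have Zsum k : Z k ^+ 2 <= 2 * (\sum_(1 <= s < k.+1) psi s * g s / (1 + w s ^+ 2))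
    + \sum_(1 <= s < k.+1) psi s ^+ 2 * v s.
  elim: k => [|k IHk]; first by rewrite ahr_Z0 !big_geq// expr0n/= mulr0 addr0.
  have := ahr_Z_step k; rewrite !(big_nat_recr k.+1)//=.
  by move: IHk; lra.
have crossE : \sum_(1 <= s < t.+1) psi s * g s / (1 + w s ^+ 2) =
  alpha t * \sum_(1 <= s < t.+1) psi s * g s
       / ((1 + w s ^+ 2) * Num.max (alpha t) (Z s.-1)).
  rewrite big_distrr/=; apply: eq_big_nat => s /andP[s1 st].
  rewrite max_l; last by rewrite Zs// prednK.
  by field; rewrite !gt_eqF// ahr_add1_sqr_w_gt0.
rewrite -(ler_pXn2r (ltn0Sn 1)) ?nnegrE ?mnorm_ge0 ?(ltW at0)//.
rewrite (le_trans (Zsum t))// crossE (le_trans _ (hal _ t1n))// lerD ?hQ//.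
by rewrite ler_pM2l// ler_pM2l// hD.
Qed.

Variables (y : nat -> R) (theta theta_star : 'cV[R]_d).
Variable t : nat.
Hypothesis model : forall s, (1 <= s <= t)%N ->
  y s = dotv (phi s) theta_star + noise s.
Hypothesis star_ball : ball2 B theta_star.
Hypothesis argmin : is_ahr_estimator p nuhat phi y t theta.

Local Notation x := (theta - theta_star).
Local Notation a s := (dotv (u s) x).

Lemma ahr_residual s : (1 <= s <= t)%N ->
  (y s - dotv (phi s) theta) / sigma s = z s - a s.
Proof.
move=> st; rewrite model// /ahr_z /ahr_u dotvZl dotvDr dotvNr.
by field; rewrite gt_eqF// ahr_sigma_gt0.
Qed.

(* The derivative of the loss at theta towards theta_star is nonnegative; this is
   read off the quadratic upper bound huber_smooth, without differentiating. *)
Lemma ahr_optimality : lambda * dotv theta x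
  <= \sum_(1 <= s < t.+1) clip (itau s) (z s - a s) * a s.
Proof.
rewrite -subr_ge0.
(* The segment from theta to theta_star stays in the ball, so every h in (0, 1] is admissible; [C]
   collects the second-order terms. *)
pose C := lambda / 2 * dotv x x + \sum_(1 <= s < t.+1) a s ^+ 2 / 2.
have [thB opt] := argmin.
have B0 : 0 <= B by rewrite (le_trans _ thB)// sqrtr_ge0.
apply: (@linear_coef_ge0 _ _ C).
  rewrite addr_ge0 ?mulr_ge0 ?dotvv_ge0 ?divr_ge0 ?(ltW lambda_gt0)//.
  by rewrite sumr_ge0// => s _; rewrite divr_ge0 ?sqr_ge0.
move=> h /andP[h0 h1].
have quadE : dotv (theta - h *: x) (theta - h *: x)
    = dotv theta theta - 2 * h * dotv theta x + h ^+ 2 * dotv x x.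
  rewrite !(dotvDl, dotvDr, dotvNl, dotvNr, dotvZl, dotvZr).
  by rewrite (dotvC theta_star theta); ring.
have inball : ball2 B (theta - h *: x).
  rewrite /ball2/= -(ler_pXn2r (ltn0Sn 1)) ?nnegrE ?sqrtr_ge0// sqr_norm2.
  have e1 : dotv theta theta <= B ^+ 2.
    by rewrite -sqr_norm2 lerXn2r ?nnegrE ?sqrtr_ge0.
  have e2 : dotv theta_star theta_star <= B ^+ 2.
    by rewrite -sqr_norm2 lerXn2r ?nnegrE ?sqrtr_ge0.
  have e3 : 0 <= (1 - h) * h * dotv x x.
    by rewrite mulr_ge0 ?dotvv_ge0// mulr_ge0 ?subr_ge0// ltW.
  have -> : dotv (theta - h *: x) (theta - h *: x) =
    (1 - h) * dotv theta theta + h * dotv theta_star theta_star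
    - (1 - h) * h * dotv x x.
    rewrite !(dotvDl, dotvDr, dotvNl, dotvNr, dotvZl, dotvZr).
    by rewrite (dotvC theta_star theta); ring.
  have h1' : 0 <= 1 - h by rewrite subr_ge0.
  have := ler_wpM2l h1' e1; have := ler_wpM2l (ltW h0) e2; lra.
have /= := opt _ inball; rewrite /ahr_loss !sqr_norm2 quadE => le1.
have le2 : \sum_(1 <= s < t.+1) huber (ahr_tau p nuhat phi s)
     ((y s - dotv (phi s) (theta - h *: x)) / sigma s)
  <= \sum_(1 <= s < t.+1) (huber (ahr_tau p nuhat phi s)
     ((y s - dotv (phi s) theta) / sigma s)
     + h * (clip (itau s) (z s - a s) * a s) + h ^+ 2 * (a s ^+ 2 / 2)).
  apply: ler_sum_nat => s /andP[s1 st].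
  have -> : (y s - dotv (phi s) (theta - h *: x)) / sigma s
    = (y s - dotv (phi s) theta) / sigma s + h * a s.
    rewrite dotvDr dotvNr dotvZr /ahr_u dotvZl.
    by field; rewrite gt_eqF// ahr_sigma_gt0.
  rewrite ahr_tauE// ahr_residual ?s1// (le_trans (huber_smooth _ _ (ahr_itau_ge0 s)))//.
  by rewrite le_eqVlt; apply/orP; left; apply/eqP; ring.
move: (le_trans le1 (lerD (lexx _) le2)).
rewrite !big_split/= -!big_distrr/= /C.
by lra.
Qed.

(** If |z| i <= 1/2, both z and z - a lie where [clip] is the identity, and the difference is a. At
    the other indices only monotonicity is left. *)
Lemma ahr_curvature s : `|a s| * itau s <= 2^-1 ->
  a s ^+ 2 - (2^-1 < `|z s| * itau s)%R%:R * a s ^+ 2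
  <= (psi s - clip (itau s) (z s - a s)) * a s.
Proof.
move=> ai; have i0 := ahr_itau_ge0 s.
have [zi|zi] := ltP 2^-1 (`|z s| * itau s); rewrite ?mul1r ?mul0r ?subr0 ?subrr.
  have := clip_monotone (z s) (z s - a s) i0.
  by rewrite subKr.
rewrite /ahr_psi !clip_id.
- by rewrite subKr expr2.
- by rewrite (le_trans (ler_wpM2r i0 (ler_normB _ _)))// mulrDl; lra.
- by lra.
Qed.

Lemma ahr_error_bound : 0 <= B ->
  (forall s, (1 <= s <= t)%N -> `|a s| * itau s <= 2^-1) ->
  \sum_(1 <= s < t.+1) (2^-1 < `|z s| * itau s)%R%:R * v s <= 2^-1 ->
  mnorm (H t) x <= 2 * (Num.sqrt lambda * B + Z t).
Proof.
move=> B0 small bad.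
set N := mnorm (H t) x; have N0 : 0 <= N by exact: mnorm_ge0.
have NE : N ^+ 2 = lambda * dotv x x + \sum_(1 <= s < t.+1) a s ^+ 2.
  by rewrite sqr_mnorm ?ahr_H_ge0// ahr_H_quad.
(* Each bad index costs at most v_s N^2 by duality, so a total weight of 1/2 costs half the
   curvature. *)
have bad_le : \sum_(1 <= s < t.+1) (2^-1 < `|z s| * itau s)%R%:R * a s ^+ 2
    <= 2^-1 * N ^+ 2.
  rewrite (le_trans _ (ler_wpM2r (sqr_ge0 N) bad))// mulr_suml.
  apply: ler_sum_nat => s /andP[s1 st]; rewrite -mulrA ler_wpM2l//.
  have hs : (1 <= s <= t)%N by rewrite s1.
  rewrite (le_trans _ (ler_wpM2r (sqr_ge0 N) (ahr_u_K_le hs)))//.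
  rewrite -sqr_mnorm ?ahr_K_ge0// -exprMn -[leLHS]real_normK ?num_real//.
  rewrite lerXn2r ?nnegrE ?mulr_ge0 ?mnorm_ge0// ler_norml -[in X in X && _]lerN2 opprK -dotvNl.
  have dn (x' : 'cV[R]_d) : dotv x' x <= mnorm (K t) x' * N.
    exact: (dotv_le_mnorm _ _ (ahr_KH t) (ahr_H_tr t) (ahr_K_tr t) (ahr_H_ge0 t)).
  have := dn (- u s); rewrite -scaleN1r mnormZ normrN1 mul1r => ->.
  exact: dn.
have SE : \sum_(1 <= s < t.+1) psi s * a s = dotv (S t) x.
  by rewrite dotvC dotv_sumr; apply: eq_bigr => s _; rewrite dotvZr dotvC.
have Sle : dotv (S t) x <= Z t * N.
  exact: (dotv_le_mnorm _ _ (ahr_KH t) (ahr_H_tr t) (ahr_K_tr t) (ahr_H_ge0 t)).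
have starle : - (lambda * dotv theta_star x) <= Num.sqrt lambda * B * N.
  have cs : `|dotv theta_star x| <= norm2 theta_star * norm2 x.
    rewrite -[leLHS]sqrtr_sqr -sqrtrM ?dotvv_ge0// ler_wsqrtr//.
    have := @cauchy_schwarz R d 1%:M theta_star x (trmx1 _ _).
    rewrite !mul1mx; apply=> x'; rewrite mul1mx; exact: dotvv_ge0.
  have xN : Num.sqrt lambda * norm2 x <= N.
    rewrite -(ler_pXn2r (ltn0Sn 1)) ?nnegrE ?mulr_ge0 ?sqrtr_ge0//.
    rewrite exprMn sqr_sqrtr ?(ltW lambda_gt0)// sqr_norm2 sqr_mnorm ?ahr_H_ge0//.
    exact: ahr_H_ge.
  have cs2 : - dotv theta_star x <= B * norm2 x.
    rewrite (le_trans (ler_norm _))// normrN (le_trans cs)// ler_wpM2r ?sqrtr_ge0//.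
  rewrite -mulrN -[X in X * _]sqr_sqrtr ?(ltW lambda_gt0)// expr2.
  rewrite -!mulrA ler_wpM2l ?sqrtr_ge0//.
  rewrite (le_trans (ler_wpM2l (sqrtr_ge0 _) cs2))// mulrCA ler_wpM2l//.
have curv : \sum_(1 <= s < t.+1) a s ^+ 2
    - \sum_(1 <= s < t.+1) (2^-1 < `|z s| * itau s)%R%:R * a s ^+ 2
  <= \sum_(1 <= s < t.+1) psi s * a s
    - \sum_(1 <= s < t.+1) clip (itau s) (z s - a s) * a s.
  rewrite -!sumrB; apply: ler_sum_nat => s hs.
  by rewrite -mulrBl ahr_curvature ?small.
have opt := ahr_optimality.
have thE : dotv theta x = dotv x x + dotv theta_star x by rewrite -dotvDl subrK.
(* Splitting theta = x + theta_star in the optimality condition restores lambda |x|^2, the part of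
   N^2 that the data terms lack. *)
have key : 2^-1 * N ^+ 2 <= (Num.sqrt lambda * B + Z t) * N.
  by move: curv opt; rewrite SE thE; lra.
have [->|Nn0] := eqVneq N 0.
  by rewrite mulr_ge0// addr_ge0 ?mnorm_ge0// mulr_ge0 ?sqrtr_ge0.
have Npos : 0 < N by rewrite lt_neqAle eq_sym Nn0.
by move: key; rewrite expr2 mulrA ler_pM2r//; lra.
Qed.

End Trajectory.

(** * The prescribed constants and the three kinds of increments *)

Section Tuning.
Context {R : realType} {d : nat}.
Variables (p : ahr_params R) (delta : R).

Local Notation T := (ahr_T p).
Local Notation eps := (ahr_eps p).
Local Notation L := (ahr_L p).
Local Notation B := (ahr_B p).
Local Notation lambda := (ahr_lambda p).
Local Notation smin := (ahr_sigma_min p).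
Local Notation c0 := (ahr_c0 p).
Local Notation c1 := (ahr_c1 p).
Local Notation tau0 := (ahr_tau0 p).
Local Notation b := (ahr_b p).
Local Notation kappa := (ahr_kappa (d := d) p).
Local Notation ell := (ln (2 * T%:R ^+ 2 / delta)).
Local Notation ei := ((1 - eps) / (2 * (1 + eps))).
Local Notation lnT := (ln (3 * T%:R : R)).

Hypotheses (d_ge1 : (1 <= d)%N) (T_ge1 : (1 <= T)%N).
Hypotheses (eps_itv : 0 < eps <= 1) (L_gt0 : 0 < L) (B_gt0 : 0 < B).
Hypotheses (lambda_gt0 : 0 < lambda) (smin_gt0 : 0 < smin) (b_gt0 : 0 < b).
Hypothesis delta_itv : 0 < delta < 1.
Hypothesis c0E : c0 = 1 / Num.sqrt (23 * ell).
Hypothesis c1E : c1 = lnT `^ ((1 - eps) / (1 + eps))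
         / (48 * ell `^ (2 / (1 + eps))).
Hypothesis tau0E : tau0 = Num.sqrt (2 * kappa) * b * lnT `^ ei
           / ell `^ (1 / (1 + eps)).

Lemma ahr_eps_gt : 0 < 1 + eps.
Proof. by case/andP: eps_itv => *; lra. Qed.

Lemma ahr_ei_ge0 : 0 <= ei.
Proof.
by case/andP: eps_itv => e0 e1; rewrite divr_ge0//; lra.
Qed.

Lemma ahr_ell_ge : 2^-1 <= ell.
Proof.
case/andP: delta_itv => dl0 dl1; apply: (le_trans ln2_ge).
have T1 : 1 <= T%:R ^+ 2 :> R by rewrite exprn_ege1// ler1n.
rewrite ler_ln ?posrE//; last by rewrite divr_gt0// mulr_gt0//; lra.
rewrite ler_pdivlMr//; nra.
Qed.

Lemma ahr_ell_gt0 : 0 < ell.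
Proof. by have := ahr_ell_ge; lra. Qed.

Lemma ahr_kappa_gt0 : 0 < kappa.
Proof.
rewrite mulr_gt0 ?ltr0n// ln_gt0// ltrDl divr_gt0 ?mulr_gt0 ?ltr0n//.
Qed.

Lemma ahr_lnT_gt0 : 0 < lnT.
Proof.
rewrite ln_gt0//; have : 1 <= T%:R :> R by rewrite ler1n.
by lra.
Qed.

Lemma ahr_c0_gt0 : 0 < c0.
Proof.
by rewrite c0E div1r invr_gt0 sqrtr_gt0 mulr_gt0// ahr_ell_gt0.
Qed.

Lemma sqr_ahr_c0 : c0 ^+ 2 * (23 * ell) = 1.
Proof.
have h : 0 < 23 * ell by rewrite mulr_gt0// ahr_ell_gt0.
rewrite c0E div1r exprVn sqr_sqrtr ?(ltW h)// mulVf// gt_eqF//.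
Qed.

Lemma ahr_c1_gt0 : 0 < c1.
Proof.
by rewrite c1E divr_gt0 ?mulr_gt0 ?powR_gt0 ?ahr_lnT_gt0 ?ahr_ell_gt0.
Qed.

Lemma ahr_tau0_gt0 : 0 < tau0.
Proof.
by rewrite tau0E divr_gt0 ?mulr_gt0 ?powR_gt0 ?ahr_lnT_gt0 ?ahr_ell_gt0//
  sqrtr_gt0 mulr_gt0// ahr_kappa_gt0.
Qed.

(** The relation that [c1] is made for; [ahr_step_small] uses it with 16 in place of 48. *)
Lemma sqr_ahr_tau0 : tau0 ^+ 2 = 48 * (c1 * (2 * kappa * b ^+ 2)).
Proof.
have k0 := ahr_kappa_gt0; have l0 := ahr_ell_gt0.
have e0 := ahr_eps_gt.
have k20 : 0 <= 2 * kappa by rewrite mulr_ge0// ltW.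
rewrite tau0E c1E !exprMn exprVn sqr_sqrtr//.
rewrite -![(_ `^ _) ^+ 2]powR_mulrn ?powR_ge0// -!powRrM.
have -> : ei * 2 = (1 - eps) / (1 + eps) by field; rewrite gt_eqF.
have -> : 1 / (1 + eps) * 2 = 2 / (1 + eps) by rewrite mulrAC mul1r.
by field; rewrite gt_eqF// powR_gt0.
Qed.

(** The equation that [tau0] solves: the Hölder bound on the sum of the moment bounds becomes
    exactly ell. *)
Lemma ahr_tau0_powR : tau0 `^ (1 + eps) * ell
  = b `^ (1 + eps) * ((2 * kappa) `^ ((1 + eps) / 2) * lnT `^ ((1 - eps) / 2)).
Proof.
have k0 := ahr_kappa_gt0; have l0 := ahr_ell_gt0.
have e0 := ahr_eps_gt; have lT := ahr_lnT_gt0.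
have k20 : 0 <= 2 * kappa by rewrite mulr_ge0// ltW.
rewrite tau0E; move: (2 * kappa) k20 => k2 k20.
rewrite !powRM ?mulr_ge0 ?sqrtr_ge0 ?invr_ge0 ?powR_ge0 ?(ltW b_gt0)//.
rewrite -powR12_sqrt// powRV ?powR_ge0// -!powRrM.
have -> : 1 / (1 + eps) * (1 + eps) = 1 by field; rewrite gt_eqF.
have -> : ei * (1 + eps) = (1 - eps) / 2 by field; rewrite gt_eqF.
rewrite powRr1 ?(ltW l0)// (mulrC (2^-1 : R)).
by field; rewrite gt_eqF.
Qed.

Section Path.
Variables (nuhat noise : nat -> R) (phi : nat -> 'cV[R]_d).
Local Notation sigma := (ahr_sigma p nuhat phi).
Local Notation w := (ahr_w p nuhat phi).
Local Notation u := (ahr_u p nuhat phi).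
Local Notation v := (ahr_v p nuhat phi).
Local Notation K := (ahr_K p nuhat phi).
Local Notation H := (ahr_H p nuhat phi).
Local Notation itau := (ahr_itau p nuhat phi).
Local Notation z := (ahr_z p nuhat phi noise).
Local Notation psi := (ahr_psi p nuhat phi noise).
Local Notation S := (ahr_S p nuhat phi noise).
Local Notation Z := (ahr_Z p nuhat phi noise).
Local Notation g := (ahr_g p nuhat phi noise).

(* |z_s / tau_s|^(1 + eps) and the bound b^(1 + eps) / tau_s^(1 + eps) on its
   conditional expectation *)
Definition ahr_moment (s : nat) : R := (`|z s| * itau s) `^ (1 + eps).
Definition ahr_moment_bound (s : nat) : R := (b * itau s) `^ (1 + eps).

(** With D = 4 x ell and Q = 4 x^2 ell, where x = tau0 t^e, the closing condition of [ahr_Z_bound]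
    reads 96 ell^2 + 4 ell <= 144 ell^2, true for ell >= 1/2. Twice this is the second term of
    [ahr_beta]. *)
Definition ahr_alpha (t : nat) : R := 12 * (tau0 * t%:R `^ ei * ell).

(* X1: weight of the large residuals; X2 and X3: quadratic and cross terms of the
   recursion for |S_t|^2. Replacing alpha_t by max (alpha_t, Z_(s-1)) makes X3
   bounded without a stopping time; on the good event the maximum is alpha_t. *)
Definition ahr_X1 (s : nat) : R :=
  2^-1 * ((2^-1 < `|z s| * itau s)%R%:R * v s / c0 ^+ 2).
Definition ahr_X2 (t s : nat) : R :=
  2^-1 * (psi s ^+ 2 * v s / (tau0 * t%:R `^ ei) ^+ 2).
Definition ahr_coef (t s : nat) : R :=
  2^-1 * (g s / ((1 + w s ^+ 2) * Num.max (ahr_alpha t) (Z s.-1)))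
  / (tau0 * t%:R `^ ei).
Definition ahr_X3 (t s : nat) : R := ahr_coef t s * psi s.

Let i0 s := ahr_itau_ge0 nuhat phi ahr_tau0_gt0 s.

Lemma natr_ei_ge1 (s : nat) : (1 <= s)%N -> 1 <= s%:R `^ ei :> R.
Proof.
by move=> s1; rewrite -[leLHS](powRr0 s%:R) ler_powR ?ahr_ei_ge0// ler1n.
Qed.

Lemma ler_natr_ei (s t : nat) : (s <= t)%N -> s%:R `^ ei <= t%:R `^ ei :> R.
Proof.
by move=> st; rewrite ge0_ler_powR ?ahr_ei_ge0 ?nnegrE ?ler0n// ler_nat.
Qed.

Lemma ahr_sqrt_v_le1 s : Num.sqrt (v s) <= 1.
Proof.
rewrite -[leRHS]sqrtr1 ler_wsqrtr// /ahr_v ler_pdivrMr ?ahr_add1_sqr_w_gt0//.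
by rewrite mul1r lerDr.
Qed.

Lemma sqr_ahr_itau s : (1 <= s)%N -> itau s ^+ 2 * (tau0 * s%:R `^ ei) ^+ 2 = v s.
Proof.
move=> s1; rewrite -exprMn /ahr_itau divfK ?sqr_sqrtr ?ahr_v_ge0//.
by rewrite gt_eqF// mulr_gt0 ?ahr_tau0_gt0// (lt_le_trans ltr01) ?natr_ei_ge1.
Qed.

Lemma ahr_itau_le s : (1 <= s)%N -> itau s <= w s / tau0.
Proof.
move=> s1; have t0 := ahr_tau0_gt0; rewrite /ahr_itau.
have se := natr_ei_ge1 s1.
rewrite ler_pM ?sqrtr_ge0 ?invr_ge0 ?mulr_ge0 ?powR_ge0 ?(ltW t0)//.
  by rewrite -[leRHS]ger0_norm ?ahr_w_ge0// -sqrtr_sqr ler_wsqrtr// ahr_v_le_sqr.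
rewrite lef_pV2 ?posrE ?ler_peMr ?(ltW t0)//.
by rewrite mulr_gt0// (lt_le_trans ltr01).
Qed.

Lemma ahr_itau_le_inv s : (1 <= s)%N -> itau s <= tau0^-1.
Proof.
move=> s1; have t0 := ahr_tau0_gt0; rewrite /ahr_itau ler_pdivrMr; last first.
  by rewrite mulr_gt0// (lt_le_trans ltr01) ?natr_ei_ge1.
rewrite mulKf ?gt_eqF// (le_trans (ahr_sqrt_v_le1 _))// natr_ei_ge1//.
Qed.

(** The exponent of s in tau_s makes each summand a multiple of v_s^a s^-(1 - a) with a = (1 + eps)
    / 2, the form required by [holder_harmonic]. *)
Lemma ahr_moment_bound_sum : (forall s, (1 <= s <= T)%N -> norm2 (phi s) <= L) ->
  \sum_(1 <= s < T.+1) ahr_moment_bound s <= ell.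
Proof.
move=> phiL; have t0 := ahr_tau0_gt0; have k0 := ahr_kappa_gt0.
have l0 := ahr_ell_gt0; have e0 := ahr_eps_gt.
pose a := (1 + eps) / 2.
have a01 : 0 < a <= 1 by case/andP: eps_itv => *; rewrite /a; lra.
have aE : 1 - a = (1 - eps) / 2 by rewrite /a; field.
have mE s : (1 <= s)%N -> ahr_moment_bound s
    = b `^ (1 + eps) / tau0 `^ (1 + eps) * (v s `^ a * s%:R^-1 `^ (1 - a)).
  move=> s1; rewrite /ahr_moment_bound /ahr_itau.
  have s0 : 0 < s%:R :> R by rewrite ltr0n.
  rewrite powRM ?(ltW b_gt0) ?divr_ge0 ?mulr_ge0 ?sqrtr_ge0 ?powR_ge0 ?(ltW t0)//.
  rewrite powRM ?sqrtr_ge0 ?invr_ge0 ?mulr_ge0 ?powR_ge0 ?(ltW t0)//.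
  rewrite !powRV ?mulr_ge0 ?powR_ge0 ?(ltW t0) ?(ltW s0)//.
  rewrite powRM ?powR_ge0 ?(ltW t0)// -powR12_sqrt ?ahr_v_ge0// -!powRrM.
  have -> : ei * (1 + eps) = 1 - a by rewrite aE; field; rewrite gt_eqF.
  have -> : 2^-1 * (1 + eps) = a by rewrite /a mulrC.
  by rewrite invfM; ring.
have pot := ahr_potential nuhat lambda_gt0 smin_gt0 d_ge1 phiL.
(* Relaxed to 2 kappa because that is the quantity inside [tau0]. *)
have pot2 : \sum_(1 <= s < T.+1) v s <= 2 * kappa by rewrite (le_trans pot)//; lra.
have k20 : 0 < 2 * kappa by rewrite mulr_gt0.
have := holder_harmonic T_ge1 a01 k20 (ahr_v_ge0 p nuhat phi) pot2.
have -> : \sum_(1 <= s < T.+1) ahr_moment_bound s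
    = \sum_(1 <= s < T.+1) b `^ (1 + eps) / tau0 `^ (1 + eps)
        * (v s `^ a * s%:R^-1 `^ (1 - a)).
  by apply: eq_big_nat => s /andP[s1 _]; exact: mE.
rewrite -big_distrr/= => h.
have c : 0 <= b `^ (1 + eps) / tau0 `^ (1 + eps) by rewrite divr_ge0 ?powR_ge0.
apply: (le_trans (ler_wpM2l c h)).
rewrite mulrAC ler_pdivrMr ?powR_gt0//.
by rewrite aE mulrC [leRHS]mulrC ahr_tau0_powR mulrC.
Qed.

(** On the bad event [ahr_moment s] >= 2^-(1 + eps) >= 1/4, the origin of the factor 4; dividing v
    by c0^2 keeps the increment at most 1/2, where exp is at most 2. *)
Lemma ahr_X1_exp s : (1 <= s)%N ->
  0 <= ahr_X1 s <= 2^-1 /\ expR (ahr_X1 s) <= 1 + 4 * ahr_moment s.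
Proof.
move=> s1; have c00 := ahr_c0_gt0; rewrite /ahr_X1.
have vc : 0 <= v s / c0 ^+ 2 <= 1.
  rewrite divr_ge0 ?ahr_v_ge0 ?sqr_ge0//= ler_pdivrMr ?exprn_gt0// mul1r.
  exact: ahr_v_le.
case: (ltP 2^-1 (`|z s| * itau s)) => zi; last first.
  by rewrite !mul0r mulr0 expR0 lexx invr_ge0 ler0n; split=> //; rewrite lerDl mulr_ge0// powR_ge0.
rewrite mul1r; move: (v s / _) vc => x /andP[x0 x1].
split; first by apply/andP; split; lra.
apply: (le_trans (expR_le_quad _)); first by lra.
have m4 : 1 <= 4 * ahr_moment s.
  have zi' : 2^-1 `^ (1 + eps) <= ahr_moment s.
    apply: ge0_ler_powR; rewrite ?nnegrE ?(ltW ahr_eps_gt) ?(ltW zi)//.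
    by rewrite mulr_ge0.
  have : 2^-1 `^ 2%:R <= 2^-1 `^ (1 + eps) :> R.
    rewrite ger_powR//; last by case/andP: eps_itv => *; lra.
    by apply/andP; split; lra.
  by rewrite powR_mulrn//; lra.
nra.
Qed.

(** As s <= t and v_s = (itau_s tau0 s^e)^2, twice the increment is at most (psi itau)^2 <= 1, hence
    at most the moment; the factor 1/2 absorbs the second-order term. *)
Lemma ahr_X2_exp t s : (1 <= s <= t)%N ->
  0 <= ahr_X2 t s <= 2^-1 /\ expR (ahr_X2 t s) <= 1 + ahr_moment s.
Proof.
move=> /andP[s1 st]; rewrite /ahr_X2.
have t0 := ahr_tau0_gt0; have se := natr_ei_ge1 s1.
have s0 : 0 < tau0 * s%:R `^ ei by rewrite mulr_gt0// (lt_le_trans ltr01).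
have st' : tau0 * s%:R `^ ei <= tau0 * t%:R `^ ei by rewrite ler_pM2l// ler_natr_ei.
have tt0 := lt_le_trans s0 st'.
set x := _ / _.
have x0 : 0 <= x by rewrite divr_ge0 ?sqr_ge0// mulr_ge0 ?sqr_ge0 ?ahr_v_ge0.
have xle : x <= (psi s * itau s) ^+ 2.
  rewrite /x ler_pdivrMr ?exprn_gt0// -(sqr_ahr_itau s1).
  move: (psi s) (itau s) => P I; set D := tau0 * _.
  have -> : P ^+ 2 * (I ^+ 2 * D ^+ 2) = (P * I) ^+ 2 * D ^+ 2 by ring.
  rewrite ler_wpM2l ?sqr_ge0//.
  by rewrite lerXn2r ?nnegrE ?(ltW s0) ?(ltW tt0).
have x1 : (psi s * itau s) ^+ 2 <= 1.
  rewrite -[leLHS]real_normK ?num_real// normrM (ger0_norm (i0 s)).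
  have n1 := norm_clip_le1 (z s) (i0 s).
  by apply: exprn_ile1 n1; rewrite mulr_ge0.
have xR := le_trans xle (sqr_norm_clip_le (z s) (i0 s) eps_itv).
rewrite -/(ahr_moment s) in xR.
split; first by apply/andP; split; lra.
apply: (le_trans (expR_le_quad _)); first by lra.
nra.
Qed.

(** Cauchy-Schwarz gives |g| <= w Z_(s-1), and the maximum in the denominator cancels Z_(s-1). What
    remains is w / (1 + w^2) <= sqrt v. *)
Lemma ahr_coef_le t s : (1 <= s <= t)%N -> `|ahr_coef t s| <= 2^-1 * itau s.
Proof.
move=> /andP[s1 st]; have t0 := ahr_tau0_gt0.
have s0 : 0 < tau0 * s%:R `^ ei.
  by rewrite mulr_gt0// (lt_le_trans ltr01)// natr_ei_ge1.
have st' : tau0 * s%:R `^ ei <= tau0 * t%:R `^ ei by rewrite ler_pM2l// ler_natr_ei.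
have tt0 := lt_le_trans s0 st'.
rewrite /ahr_coef; set M := Num.max _ _.
have M0 : 0 < M.
  by rewrite lt_max mulr_gt0// mulr_gt0 ?ahr_ell_gt0.
have ww := ahr_add1_sqr_w_gt0 p nuhat phi s.
have gle : `|g s| <= w s * M.
  apply: (@le_trans _ _ (w s * Z s.-1)); last first.
    by rewrite ler_wpM2l ?ahr_w_ge0// le_max lexx orbT.
  rewrite /ahr_g -sqrtr_sqr /ahr_w /ahr_Z invmx_ahr_H// -sqrtrM ?ahr_K_ge0//.
  by rewrite ler_wsqrtr// cauchy_schwarz ?ahr_K_tr// => x; exact: ahr_K_ge0.
rewrite !(normrM, normfV) -(normrM tau0) (gtr0_norm tt0) (gtr0_norm M0) (gtr0_norm ww) normr_nat.
rewrite -(mulrA 2^-1) ler_pM2l// /ahr_itau.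
have wv : w s / (1 + w s ^+ 2) <= Num.sqrt (v s).
  rewrite /ahr_v sqrtrM ?sqr_ge0// sqrtr_sqr ger0_norm ?ahr_w_ge0//.
  rewrite ler_wpM2l ?ahr_w_ge0// sqrtrV ?(ltW ww)// lef_pV2 ?posrE ?sqrtr_gt0//.
  rewrite -[leRHS]gtr0_norm// -sqrtr_sqr ler_wsqrtr// expr2 ler_peMr ?(ltW ww)//.
  by rewrite lerDl sqr_ge0.
rewrite ler_pM ?mulr_ge0 ?invr_ge0 ?(ltW tt0) ?lef_pV2//.
  by rewrite mulr_ge0 ?(ltW ww) ?(ltW M0).
rewrite ler_pdivrMr// in wv.
by rewrite ler_pdivrMr ?mulr_gt0// (le_trans gle)// mulrA ler_pM2r.
Qed.

(** Replacing psi by the centred z costs half a moment by [clip_err]; the second-order term 2 (c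
    psi)^2 costs the other half. *)
Lemma ahr_X3_exp t s : (1 <= s <= t)%N -> ahr_X3 t s <= 1 /\
  expR (ahr_X3 t s) <= 1 + ahr_coef t s * z s + ahr_moment s.
Proof.
move=> st; have cle := ahr_coef_le st; rewrite /ahr_X3.
have n1 := norm_clip_le1 (z s) (i0 s).
have err := clip_err (z s) (i0 s) eps_itv.
have sq := sqr_norm_clip_le (z s) (i0 s) eps_itv.
rewrite -/(ahr_psi p nuhat phi noise s) -/(ahr_moment s) in n1 err sq.
set c := ahr_coef t s in cle *.
have xle : `|c * psi s| <= 2^-1.
  rewrite normrM (le_trans (ler_wpM2r (normr_ge0 _) cle))//.
  by rewrite -mulrA (mulrC (itau s)); lra.
have x2 := le_trans (ler_norm _) xle.
split; first by lra.
apply: (le_trans (expR_le_quad x2)).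
have h1 : c * psi s <= c * z s + 2^-1 * ahr_moment s.
  rewrite -lerBlDl -mulrBr (le_trans (ler_norm _))// normrM.
  rewrite (le_trans (ler_wpM2r (normr_ge0 _) cle))//.
  by rewrite -mulrA (mulrC (itau s)); lra.
have h2 : (c * psi s) ^+ 2 <= 4^-1 * (psi s * itau s) ^+ 2.
  rewrite -[leLHS]real_normK ?num_real// normrM.
  have -> : 4^-1 * (psi s * itau s) ^+ 2 = (2^-1 * itau s * `|psi s|) ^+ 2.
    by rewrite (exprMn _ (2^-1 * itau s)) real_normK ?num_real//; field.
  apply: lerXn2r; rewrite ?nnegrE; first exact: mulr_ge0.
    by rewrite mulr_ge0// mulr_ge0.
  exact: ler_wpM2r.
by lra.
Qed.

(** The purpose of the fourth entry of sigma: the product is at most 2 L B w / (sigma tau0), and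
    [ahr_sigma_LB] bounds L B w / sigma by tau0 / 4. *)
Lemma ahr_step_small (x : 'cV[R]_d) s : (1 <= s)%N -> norm2 (phi s) <= L ->
  norm2 x <= 2 * B -> `|dotv (u s) x| * itau s <= 2^-1.
Proof.
move=> s1 phiL xB; have t0 := ahr_tau0_gt0; have s0 := ahr_sigma_gt0 nuhat phi smin_gt0 s.
have cs : `|dotv (u s) x| <= L / sigma s * (2 * B).
  rewrite /ahr_u dotvZl normrM gtr0_norm ?invr_gt0//.
  have -> : L / sigma s * (2 * B) = (sigma s)^-1 * (2 * B * L) by ring.
  rewrite ler_pM2l ?invr_gt0//.
  have : `|dotv (phi s) x| <= norm2 (phi s) * norm2 x.
    rewrite -[leLHS]sqrtr_sqr -sqrtrM ?dotvv_ge0// ler_wsqrtr//.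
    have := @cauchy_schwarz R d 1%:M (phi s) x (trmx1 _ _).
    by rewrite !mul1mx; apply=> x'; rewrite mul1mx; exact: dotvv_ge0.
  by move/le_trans; apply; rewrite mulrC ler_pM ?sqrtr_ge0.
have i1 := ahr_itau_le s1.
rewrite (le_trans (ler_pM (normr_ge0 _) (i0 s) cs i1))//.
have key := ahr_sigma_LB nuhat phi lambda_gt0 smin_gt0 s L_gt0 B_gt0 ahr_c1_gt0 ahr_kappa_gt0 b_gt0.
set q := Num.sqrt _ in key.
have qle : q <= tau0 / 4.
  rewrite -(ler_pXn2r (ltn0Sn 1)) ?nnegrE ?sqrtr_ge0 ?divr_ge0 ?(ltW t0)//.
  have Q0 : 0 <= c1 * (2 * kappa * b ^+ 2).
    have c10 := ahr_c1_gt0; have k0 := ahr_kappa_gt0.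
    by rewrite mulr_ge0 ?(ltW c10)// mulr_ge0 ?sqr_ge0// mulr_ge0// ltW.
  by rewrite /q sqr_sqrtr// exprMn sqr_ahr_tau0; lra.
have -> : L / sigma s * (2 * B) * (w s / tau0) = 2 * (L * B * w s) / (sigma s * tau0).
  by field; rewrite !gt_eqF.
rewrite ler_pdivrMr ?mulr_gt0//.
by have := ler_wpM2r (ltW s0) qle; lra.
Qed.

Lemma ahr_moment_bound_ge0 s : 0 <= ahr_moment_bound s.
Proof. exact: powR_ge0. Qed.

Lemma ahr_moment_bound_sum_le t : (t <= T)%N ->
  (forall s, (1 <= s <= T)%N -> norm2 (phi s) <= L) ->
  \sum_(1 <= s < t.+1) ahr_moment_bound s <= ell.
Proof.
move=> tT phiL; apply: le_trans (ahr_moment_bound_sum phiL).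
rewrite [leRHS](big_cat_nat (n := t.+1))//= lerDl sumr_ge0// => s _.
exact: ahr_moment_bound_ge0.
Qed.

Lemma ahr_moment_noise s :
  (itau s / sigma s) `^ (1 + eps) * `|noise s| `^ (1 + eps) = ahr_moment s.
Proof.
have s0 := ahr_sigma_gt0 nuhat phi smin_gt0 s.
have is0 : 0 <= itau s / sigma s by apply: divr_ge0; [exact: i0 | exact: ltW].
rewrite -powRM// /ahr_moment /ahr_z normrM normfV.
by rewrite (gtr0_norm s0); congr (_ `^ _); ring.
Qed.

Lemma ahr_moment_nu nu s : 0 <= nu -> nu <= b * nuhat s ->
  (itau s / sigma s) `^ (1 + eps) * nu `^ (1 + eps) <= ahr_moment_bound s.
Proof.
move=> nu0 nub; have s0 := ahr_sigma_gt0 nuhat phi smin_gt0 s.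
have e0 := ahr_eps_gt.
have is0 : 0 <= itau s / sigma s by apply: divr_ge0; [exact: i0 | exact: ltW].
rewrite -powRM//; apply: ge0_ler_powR; rewrite ?nnegrE ?(ltW e0)//.
- exact: mulr_ge0.
- by apply: mulr_ge0; [exact: ltW | exact: i0].
rewrite mulrAC ler_pdivrMr// (mulrC b) -(mulrA _ b) ler_wpM2l ?i0//.
by rewrite (le_trans nub)// ler_pM2l// ahr_sigma_nuhat.
Qed.

(** A bound uniform over trajectories, so that the coefficient times the noise is integrable. *)
Lemma ahr_coef_noise_bound t s : (1 <= s <= t)%N ->
  `|ahr_coef t s / sigma s| <= (tau0 * smin)^-1.
Proof.
move=> st; have s0 := ahr_sigma_gt0 nuhat phi smin_gt0 s.
have t0 := ahr_tau0_gt0; have /andP[s1 _] := st.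
rewrite normrM normfV (gtr0_norm s0) invfM ler_pM ?invr_ge0 ?(ltW s0)//.
  rewrite (le_trans (ahr_coef_le st))//; have := ahr_itau_le_inv s1.
  by have := i0 s; lra.
by rewrite lef_pV2 ?posrE// ahr_sigma_ge.
Qed.

Variables (y : nat -> R) (theta : nat -> 'cV[R]_d) (theta_star : 'cV[R]_d).

Lemma ahr_good_path :
  ball2 B theta_star ->
  (forall s, (1 <= s <= T)%N -> norm2 (phi s) <= L) ->
  (forall s, (1 <= s <= T)%N -> y s = dotv (phi s) theta_star + noise s) ->
  (forall t, (1 <= t <= T)%N -> is_ahr_estimator p nuhat phi y t (theta t)) ->
  (forall t, (1 <= t <= T)%N ->
    [/\ \sum_(1 <= s < t.+1) ahr_X1 s < 4 * ell + ell,
        \sum_(1 <= s < t.+1) ahr_X2 t s < ell + ell &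
        \sum_(1 <= s < t.+1) ahr_X3 t s < ell + ell]) ->
  forall t, (1 <= t <= T)%N ->
  mnorm (H t) (theta t - theta_star) <= ahr_beta d p delta t.
Proof.
move=> starB phiL model est good.
have t0 := ahr_tau0_gt0; have l0 := ahr_ell_gt0.
have te t : (1 <= t)%N -> 0 < tau0 * t%:R `^ ei.
  by move=> t1; rewrite mulr_gt0// (lt_le_trans ltr01)// natr_ei_ge1.
have Zle : forall t, (1 <= t <= T)%N -> Z t <= ahr_alpha t.
  (* Both thresholds are 2 ell; undoing the factor 1/2 in the increments yields the two 4s. *)
  apply: (@ahr_Z_bound _ _ p nuhat phi noise lambda_gt0 ahr_alpha
    (fun t => 4 * (tau0 * t%:R `^ ei * ell))
    (fun t => 4 * ((tau0 * t%:R `^ ei) ^+ 2 * ell)) T).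
  - by move=> t /te tt; rewrite mulr_gt0// mulr_gt0.
  - move=> s t st; rewrite ler_pM2l// ler_pM2r// ler_pM2l//.
    exact: ler_natr_ei.
  - move=> t /andP[/te tt _]; rewrite /ahr_alpha.
    move: (tau0 * _) tt => x x0; have lge := ahr_ell_ge.
    have : 0 <= x ^+ 2 * (ell * (ell - 2^-1)).
      by rewrite mulr_ge0 ?sqr_ge0// mulr_ge0 ?(ltW l0)// subr_ge0.
    have : 0 <= x ^+ 2 * ell by rewrite mulr_ge0 ?sqr_ge0// ltW.
    by lra.
  - move=> t tT; have [_ _] := good t tT; case/andP: tT => /te tt _.
    have -> : \sum_(1 <= s < t.+1) ahr_X3 t s = (2 * (tau0 * t%:R `^ ei))^-1 *
      \sum_(1 <= s < t.+1) psi s * g s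
       / ((1 + w s ^+ 2) * Num.max (ahr_alpha t) (Z s.-1)).
      rewrite big_distrr/=; apply: eq_bigr => s _.
      rewrite /ahr_X3 /ahr_coef.
      move: (psi s) (g s) (_ * Num.max _ _) (tau0 * _) => P' G M D.
      by rewrite (invfM 2); ring.
    have t2 : 0 < 2 * (tau0 * t%:R `^ ei) by rewrite mulr_gt0.
    rewrite mulrC ltr_pdivrMr// => h; apply/ltW/(lt_le_trans h).
    by lra.
  - move=> t tT; have [_ + _] := good t tT; case/andP: tT => /te tt _.
    have -> : \sum_(1 <= s < t.+1) ahr_X2 t s = (2 * (tau0 * t%:R `^ ei) ^+ 2)^-1 *
      \sum_(1 <= s < t.+1) psi s ^+ 2 * v s.
      rewrite big_distrr/=; apply: eq_bigr => s _.
      rewrite /ahr_X2; move: (psi s) (v s) ((tau0 * _) ^+ 2) => P' V D.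
      by rewrite (invfM 2); ring.
    have t2 : 0 < 2 * (tau0 * t%:R `^ ei) ^+ 2 by rewrite mulr_gt0// exprn_gt0.
    rewrite mulrC ltr_pdivrMr// => h; apply/ltW/(lt_le_trans h).
    by lra.
move=> t tT; have /andP[t1 tle] := tT.
have sub_t s : (1 <= s <= t)%N -> (1 <= s <= T)%N.
  by move=> /andP[-> /leq_trans]; apply.
have model_t s : (1 <= s <= t)%N -> y s = dotv (phi s) theta_star + noise s.
  by move=> /sub_t /model.
(* The role of 23: the threshold 5 ell times 2 c0^2 is 10/23 < 1/2. *)
have bad : \sum_(1 <= s < t.+1) (2^-1 < `|z s| * itau s)%R%:R * v s <= 2^-1.
  have [+ _ _] := good t tT.
  have c00 := ahr_c0_gt0.
  have -> : \sum_(1 <= s < t.+1) ahr_X1 s = (2 * c0 ^+ 2)^-1 *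
      \sum_(1 <= s < t.+1) (2^-1 < `|z s| * itau s)%R%:R * v s.
    rewrite big_distrr/=; apply: eq_bigr => s _.
    by rewrite /ahr_X1 (invfM 2); ring.
  have c2 : 0 < 2 * c0 ^+ 2 by rewrite mulr_gt0// exprn_gt0.
  rewrite mulrC ltr_pdivrMr// => h; apply/ltW/(lt_le_trans h).
  by have := sqr_ahr_c0; lra.
have thB : ball2 B (theta t) by have [] := est t tT.
have xB : norm2 (theta t - theta_star) <= 2 * B.
  rewrite -(ler_pXn2r (ltn0Sn 1)) ?nnegrE ?sqrtr_ge0 ?mulr_ge0 ?(ltW B_gt0)//.
  have := dotvv_ge0 (theta t + theta_star).
  have e1 : dotv (theta t) (theta t) <= B ^+ 2.
    by rewrite -sqr_norm2 lerXn2r ?nnegrE ?sqrtr_ge0 ?(ltW B_gt0).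
  have e2 : dotv theta_star theta_star <= B ^+ 2.
    by rewrite -sqr_norm2 lerXn2r ?nnegrE ?sqrtr_ge0 ?(ltW B_gt0).
  rewrite sqr_norm2 !(dotvDl, dotvDr, dotvNl, dotvNr) (dotvC theta_star (theta t)).
  by rewrite exprMn; lra.
have err := ahr_error_bound lambda_gt0 smin_gt0 t0 model_t starB (est t tT)
  (ltW B_gt0) (fun s hs => ahr_step_small (proj1 (andP hs)) (phiL s (sub_t s hs)) xB) bad.
rewrite (le_trans err)// /ahr_beta.
have hZ := Zle t tT.
(* In tau0 ell the powers of ell combine to 1 - 1 / (1 + eps) = eps / (1 + eps). *)
have -> : 24 * t%:R `^ ei * Num.sqrt (2 * kappa) * b * lnT `^ ei
    * ell `^ (eps / (1 + eps)) = 2 * ahr_alpha t.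
  rewrite /ahr_alpha tau0E.
  have -> : eps / (1 + eps) = 1 - 1 / (1 + eps).
    by field; rewrite gt_eqF// ahr_eps_gt.
  rewrite powRB; last by rewrite (gt_eqF l0) implybT.
  rewrite powRr1 ?(ltW l0)//.
  by field; rewrite gt_eqF// powR_gt0.
have : 0 <= Num.sqrt lambda * B by rewrite mulr_ge0 ?sqrtr_ge0 ?(ltW B_gt0).
by lra.
Qed.

End Path.
End Tuning.

(** * Exponential supermartingales *)

Section SubSigmaAlgebra.
Context {d : measure_display} {Omega : measurableType d} {R : realType}.
Implicit Types (G : set (set Omega)) (X : Omega -> R).

(** Moves G-measurability to the type whose sigma-algebra is G, where the closure lemmas for
    measurable functions apply. *)
Lemma sub_measurableP G X : sigma_algebra setT G ->
  sub_measurable G X <->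
  measurable_fun [set: g_sigma_algebraType G] (X : g_sigma_algebraType G -> R).
Proof.
move=> sG; split=> [h _ B mB|h B mB].
  by rewrite setTI (measurable_g_measurableTypeE sG); exact: h.
by have := h measurableT B mB; rewrite setTI (measurable_g_measurableTypeE sG).
Qed.

Lemma sub_measurable_fun G X : G `<=` measurable -> sub_measurable G X ->
  measurable_fun setT X.
Proof. by move=> Gm h _ B mB; rewrite setTI; exact/Gm/h. Qed.

End SubSigmaAlgebra.

Section Weighted.
Local Open Scope ereal_scope.
Context {d : measure_display} {Omega : measurableType d} {R : realType}.
Variables (P : probability Omega R) (G : set (set Omega)).
Hypothesis G_sigma : sigma_algebra setT G.
Hypothesis G_measurable : G `<=` measurable.
Local Notation OG := (g_sigma_algebraType G).

Import HBNNSimple.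

Let sub_fun (X : Omega -> R) : measurable_fun [set: OG] (X : OG -> R) ->
  measurable_fun [set: Omega] X.
Proof. by move/(sub_measurableP _ G_sigma)/(sub_measurable_fun G_measurable). Qed.

Let sub_set (A : set OG) : measurable A -> G A.
Proof. by rewrite (measurable_g_measurableTypeE G_sigma). Qed.

Lemma ge0_integral_nnsfun_mul (h : {nnsfun OG >-> R}) (f : Omega -> R) :
  (forall w, (0 <= f w)%R) -> measurable_fun setT f ->
  \int[P]_w (h w * f w)%:E
  = \sum_(y \in range h) (y%:E * \int[P]_(w in h @^-1` [set y]) (f w)%:E).
Proof.
move=> f0 mf.
have mpre y : measurable (h @^-1` [set y] : set Omega).
  apply/G_measurable/sub_set.
  by rewrite -[X in measurable X]setTI; exact: measurable_funP.
transitivity (\int[P]_w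
   \sum_(y \in range h) (y * \1_(h @^-1` [set y]) w * f w)%:E).
  apply: eq_integral => w _; rewrite {1}fimfunE /= fsumEFin//.
  by rewrite mulr_fsuml.
rewrite ge0_integral_fsum//=; last 2 first.
- move=> y; apply/measurable_EFinP/measurable_funM => //.
  exact: measurable_funM.
- move=> y w _; rewrite lee_fin mulr_ge0//.
  by have := nnfun_muleindic_ge0 h y w; rewrite lee_fin.
apply: eq_fsbigr => y; rewrite inE => -[w0 _ hy].
rewrite [in RHS]integral_mkcond -ge0_integralZl//=.
- apply: eq_integral => w _; rewrite patchE indicE.
  case: ifP => _; first by rewrite mulr1 EFinM.
  by rewrite mulr0 mul0r mule0.
- apply/(measurable_restrictT _ (mpre y)).1/measurable_funTS.
  exact/measurable_EFinP.
- by move=> w _; rewrite patchE; case: ifP => // _; rewrite lee_fin.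
- by rewrite -hy lee_fin.
Qed.

(** From sets of G to weights by simple functions and monotone convergence. The approximants are
    taken on [OG], so their level sets lie in G. *)
Lemma ge0_integral_weighted (f g U : Omega -> R) :
  (forall w, (0 <= f w)%R) -> measurable_fun setT f ->
  (forall w, (0 <= g w)%R) -> measurable_fun setT g ->
  (forall A, G A -> \int[P]_(w in A) (f w)%:E = \int[P]_(w in A) (g w)%:E) ->
  (forall w, (0 <= U w)%R) -> sub_measurable G U ->
  \int[P]_w (U w * f w)%:E = \int[P]_w (U w * g w)%:E.
Proof.
move=> f0 mf g0 mg fg U0 /(sub_measurableP _ G_sigma) mU.
have mU' : measurable_fun [set: OG] (fun w : OG => (U w)%:E).
  exact/measurable_EFinP.
pose h := nnsfun_approx (@measurableT _ OG) mU'.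
have U0' (w : OG) : setT w -> 0 <= (U w)%:E by rewrite lee_fin.
have lim_h (k : Omega -> R) : (forall w, (0 <= k w)%R) -> measurable_fun setT k ->
  \int[P]_w (U w * k w)%:E = limn (fun n => \int[P]_w (h n w * k w)%:E).
  move=> k0 mk.
  transitivity (\int[P]_w limn (fun n => (h n w * k w)%:E)).
    apply: eq_integral => w _; apply/esym/cvg_lim => //.
    rewrite EFinM.
    under eq_fun do rewrite EFinM.
    apply: cvgeZr => //.
    exact: (cvg_nnsfun_approx (@measurableT _ OG) mU' U0').
  apply: (@monotone_convergence _ _ _ P _ measurableT
    (fun n w => (h n w * k w)%:E)).
  - move=> n; apply/measurable_EFinP/measurable_funM => //.
    by apply: sub_fun; exact: measurable_funP.
  - by move=> n w _; rewrite lee_fin mulr_ge0.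
  - move=> w _ n m nm; rewrite lee_fin ler_wpM2r//.
    by have /lefP := nd_nnsfun_approx (@measurableT _ OG) mU' nm; exact.
rewrite !lim_h//; congr (limn _); apply/funext => n.
rewrite !ge0_integral_nnsfun_mul//; apply: eq_fsbigr => y _.
rewrite fg//; apply: sub_set.
by rewrite -[X in measurable X]setTI; exact: measurable_funP.
Qed.

Lemma integrable_posneg (A : set Omega) (f : Omega -> R) : measurable A ->
  P.-integrable A (EFin \o f) ->
  P.-integrable A (EFin \o (fun w => Num.max (f w) 0)%R) /\
  P.-integrable A (EFin \o (fun w => Num.max (- f w) 0)%R).
Proof.
move=> mA intf; have mf := (measurable_EFinP _ _).1 (measurable_int _ intf).
have absE x : (`|Num.max x 0| <= `|x| :> R)%R.
  by case: (leP x 0%R) => x0; rewrite ?normr0.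
split; apply: (le_integrable mA _ _ intf).
- by apply/measurable_EFinP/measurable_maxr => //; exact: measurable_cst.
- by move=> w _; rewrite lee_fin.
- apply/measurable_EFinP/measurable_maxr; last exact: measurable_cst.
  exact: measurable_funN.
- by move=> w _; rewrite lee_fin /= -[in leRHS]normrN.
Qed.

(** Brings centred signed noise into the nonnegative setting of [ge0_integral_weighted]. *)
Lemma integral0_posneg (A : set Omega) (f : Omega -> R) : measurable A ->
  P.-integrable A (EFin \o f) -> \int[P]_(w in A) (f w)%:E = 0 ->
  \int[P]_(w in A) (Num.max (f w) 0%R)%:E
  = \int[P]_(w in A) (Num.max (- f w) 0%R)%:E.
Proof.
move=> mA intf; have [intp intn] := integrable_posneg mA intf.
have fE w : f w = (Num.max (f w) 0 - Num.max (- f w) 0)%R.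
  by case: (leP (f w) 0%R); case: (leP (- f w)%R 0%R); lra.
under eq_integral do rewrite fE EFinB.
rewrite integralB_EFin// => /eqP; rewrite sube_eq ?add0e; first by move/eqP.
- exact: integrable_fin_num.
- by rewrite fin_num_adde_defl// integrable_fin_num.
Qed.

(** In the nonnegative alternative of [is_cond_exp], testing on the whole space gives integral 0. *)
Lemma is_cond_exp0_integrable (f : Omega -> R) :
  is_cond_exp P G f (fun=> 0%R) -> P.-integrable setT (EFin \o f).
Proof.
move=> [[//|[mf f0]] _ mean0]; apply/integrableP; split.
  exact/measurable_EFinP.
have GT : G setT.
  by have [G0 GC _] := G_sigma; rewrite -(setD0 setT); exact: GC.
rewrite (eq_integral (fun w => (f w)%:E)); last first.
  by move=> w _; rewrite /= ger0_norm.
by rewrite mean0// integral0.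
Qed.

Lemma bounded_weightP (D : R) (A f : Omega -> R) :
  measurable_fun setT A -> (forall w, `|A w| <= D)%R ->
  P.-integrable setT (EFin \o f) ->
  P.-integrable setT (EFin \o (fun w => A w * f w)%R).
Proof.
move=> mA AD intf.
have -> : EFin \o (fun w => A w * f w)%R = ((EFin \o A) \* (EFin \o f)).
  by apply/funext => w /=; rewrite EFinM.
apply: integrableMr => //.
by exists D; split; [exact: num_real | move=> x Dx w _; exact: le_trans (AD w) (ltW Dx)].
Qed.

Lemma is_cond_exp0_weighted (D : R) (A f : Omega -> R) :
  is_cond_exp P G f (fun=> 0%R) -> sub_measurable G A ->
  (forall w, `|A w| <= D)%R ->
  P.-integrable setT (EFin \o (fun w => A w * f w)%R) /\
  \int[P]_w (A w * f w)%:E = 0.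
Proof.
move=> cf mA AD; have intf := is_cond_exp0_integrable cf.
have [_ _ mean0] := cf.
have D0 : (0 <= D)%R by rewrite (le_trans _ (AD point)).
have mAO := sub_measurable_fun G_measurable mA.
(* Shifting by D makes the weight nonnegative, and D f integrates to 0. *)
pose A' w := (A w + D)%R.
have mA' : sub_measurable G A'.
  apply/sub_measurableP => //; apply: measurable_funD; first exact/sub_measurableP.
  exact: measurable_cst.
have A'0 w : (0 <= A' w)%R by have := AD w; rewrite ler_norml /A'; lra.
have A'D w : (`|A' w| <= D + D)%R.
  by rewrite ger0_norm// /A' lerD2r (le_trans (ler_norm _)).
have mA'O := sub_measurable_fun G_measurable mA'.
have mf : measurable_fun setT f by exact/measurable_EFinP/measurable_int/intf.
have [intp intn] := integrable_posneg measurableT intf.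
have intA := bounded_weightP mAO AD intf.
have int' := bounded_weightP mA'O A'D intf.
have intp' := bounded_weightP mA'O A'D intp.
have intn' := bounded_weightP mA'O A'D intn.
have intD : P.-integrable setT (EFin \o (fun w => D * f w)%R).
  by apply: (@bounded_weightP D (cst D)) => // w; rewrite ger0_norm.
split=> //.
have e1 : \int[P]_w (A' w * f w)%:E = 0.
  have fE w : (A' w * f w)%:E = ((A' w * Num.max (f w) 0)%:E
      - (A' w * Num.max (- f w) 0)%:E)%E.
    rewrite -EFinB -mulrBr; congr (_ * _)%:E.
    by case: (leP (f w) 0%R); case: (leP (- f w)%R 0%R); lra.
  under eq_integral do rewrite fE.
  rewrite integralB_EFin//.
  rewrite (@ge0_integral_weighted (fun w => Num.max (f w) 0)%R
    (fun w => Num.max (- f w) 0)%R A')//.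
  - by rewrite subee// integrable_fin_num.
  - by move=> w; rewrite le_max lexx orbT.
  - by apply: measurable_maxr => //; exact: measurable_cst.
  - by move=> w; rewrite le_max lexx orbT.
  - by apply: measurable_maxr; [exact: measurable_funN|exact: measurable_cst].
  - move=> C GC; apply: integral0_posneg; first exact: G_measurable.
    + by apply: integrableS intf => //; exact: G_measurable.
    + by rewrite mean0// integral0.
have GT : G setT.
  by have [G0 GC _] := G_sigma; rewrite -(setD0 setT); exact: GC.
have e2 : \int[P]_w (D * f w)%:E = 0.
  under eq_integral do rewrite EFinM.
  by rewrite (integralZl measurableT intf) mean0// integral0 mule0.
have AE w : (A w * f w)%:E = ((A' w * f w)%:E - (D * f w)%:E)%E.
  by rewrite -EFinB -mulrBl /A' addrK.
under eq_integral do rewrite AE.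
by rewrite integralB_EFin// e1 e2 sube0.
Qed.

(** V + Q may have infinite integral, so the negative part of N is moved to the left and cancelled
    against the positive part, which has the same finite integral. *)
Lemma integral_le_centered (f V N Q : Omega -> R) :
  (forall w, 0 <= f w)%R -> (forall w, 0 <= V w)%R -> (forall w, 0 <= Q w)%R ->
  measurable_fun setT f -> measurable_fun setT V -> measurable_fun setT Q ->
  P.-integrable setT (EFin \o N) -> \int[P]_w (N w)%:E = 0 ->
  (forall w, f w <= V w + N w + Q w)%R ->
  \int[P]_w (f w)%:E <= \int[P]_w (V w + Q w)%:E.
Proof.
move=> f0 V0 Q0 mf mV mQ intN N0 fle.
have [intp intn] := integrable_posneg measurableT intN.
have eN := integral0_posneg measurableT intN N0.
pose Np w := Num.max (N w) 0%R; pose Nn w := Num.max (- N w)%R 0%R.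
have mNp : measurable_fun setT (EFin \o Np) by case/integrableP: intp.
have mNn : measurable_fun setT (EFin \o Nn) by case/integrableP: intn.
have mfE : measurable_fun setT (fun w => (f w)%:E) by exact/measurable_EFinP.
have mVQ : measurable_fun setT (fun w => (V w + Q w)%:E).
  exact/measurable_EFinP/measurable_funD.
have f0' w : setT w -> 0 <= (f w)%:E by rewrite lee_fin.
have VQ0' w : setT w -> 0 <= (V w + Q w)%:E by rewrite lee_fin addr_ge0.
have Np0 w : setT w -> 0 <= (Np w)%:E by rewrite lee_fin le_max lexx orbT.
have Nn0 w : setT w -> 0 <= (Nn w)%:E by rewrite lee_fin le_max lexx orbT.
have h : \int[P]_w ((f w)%:E + (Nn w)%:E)
    <= \int[P]_w ((V w + Q w)%:E + (Np w)%:E).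
  apply: (ge0_le_integral P measurableT).
  - by move=> w _; rewrite adde_ge0 ?f0' ?Nn0.
  - exact: emeasurable_funD.
  - exact: emeasurable_funD.
  - move=> w _; rewrite -!EFinD lee_fin /Np /Nn; have := fle w.
    by case: (leP (N w) 0%R); case: (leP (- N w)%R 0%R); lra.
move: h; rewrite (ge0_integralD P measurableT f0' mfE Nn0 mNn).
rewrite (ge0_integralD P measurableT VQ0' mVQ Np0 mNp).
have {}eN : \int[P]_w (Nn w)%:E = \int[P]_w (Np w)%:E by exact/esym.
rewrite eN.
by rewrite leeD2rE// integrable_fin_num.
Qed.

(* The bound on exp X is linear in the noise up to a moment of order 1 + eps,
   both of which integrate against the predictable weight U. *)
Lemma exp_moment_step (eps : R) (noise nu U X a q m : Omega -> R) (C C' : R) :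
  measurable_fun setT noise -> measurable_fun setT X ->
  is_cond_exp P G noise (fun=> 0%R) ->
  is_cond_exp P G (fun w => `|noise w| `^ (1 + eps))%R
                  (fun w => nu w `^ (1 + eps))%R ->
  sub_measurable G U -> sub_measurable G a -> sub_measurable G q ->
  sub_measurable G m ->
  (forall w, 0 <= U w <= C)%R -> (forall w, `|a w| <= C')%R ->
  (forall w, 0 <= q w)%R -> (forall w, 0 <= m w)%R ->
  (forall w, expR (X w) <= 1 + a w * noise w
     + q w * `|noise w| `^ (1 + eps))%R ->
  {ae P, forall w, (q w * nu w `^ (1 + eps) <= m w)%R} ->
  \int[P]_w (U w * expR (X w - m w))%:E <= \int[P]_w (U w)%:E.
Proof.
move=> mnoise mX cnoise [_ mnu moment] mU ma mq mm UC aC q0 m0 expX qm.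
(* Including exp (- m) keeps the weight predictable and bounded by C. *)
pose V w := (U w * expR (- m w))%R.
have U0 w : (0 <= U w)%R by have /andP[] := UC w.
have V0 w : (0 <= V w)%R by rewrite mulr_ge0 ?expR_ge0.
have VC w : (V w <= C)%R.
  have /andP[_ UCw] := UC w; rewrite (le_trans _ UCw)// ler_piMr//.
  by rewrite -expR0 ler_expR oppr_le0.
have mV : sub_measurable G V.
  apply/sub_measurableP => //; apply: measurable_funM; first exact/sub_measurableP.
  apply: (measurableT_comp (@measurable_expR R)); apply: measurable_funN.
  exact/sub_measurableP.
have mVO := sub_measurable_fun G_measurable mV.
have mVa : sub_measurable G (fun w => V w * a w)%R.
  by apply/sub_measurableP => //; apply: measurable_funM; exact/sub_measurableP.
have mVq : sub_measurable G (fun w => V w * q w)%R.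
  by apply/sub_measurableP => //; apply: measurable_funM; exact/sub_measurableP.
have VaD w : (`|V w * a w| <= C * C')%R by rewrite normrM ler_pM// ger0_norm.
have [intN N0] := is_cond_exp0_weighted cnoise mVa VaD.
have mpow : measurable_fun setT (fun w => `|noise w| `^ (1 + eps))%R.
  apply: (measurableT_comp (measurable_powR _)).
  exact: (measurableT_comp (@normr_measurable R setT) mnoise).
have mnuO := sub_measurable_fun G_measurable mnu.
have mVqO := sub_measurable_fun G_measurable mVq.
have mmO := sub_measurable_fun G_measurable mm.
have Vq0 w : (0 <= V w * q w)%R by rewrite mulr_ge0.
have step1 : \int[P]_w (U w * expR (X w - m w))%:E
   <= \int[P]_w (V w + V w * q w * `|noise w| `^ (1 + eps))%:E.
  have -> : \int[P]_w (U w * expR (X w - m w))%:E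
      = \int[P]_w (V w * expR (X w))%:E.
    by apply: eq_integral => w _; rewrite /V expRD mulrA mulrAC.
  apply: (integral_le_centered _ _ _ _ _ _ intN N0).
  - by move=> w; rewrite mulr_ge0 ?expR_ge0.
  - exact: V0.
  - by move=> w; rewrite mulr_ge0 ?powR_ge0.
  - apply: measurable_funM => //.
    exact: (measurableT_comp (@measurable_expR R)).
  - exact: mVO.
  - exact: measurable_funM.
  - by move=> w; have := ler_wpM2l (V0 w) (expX w); lra.
have mVE : measurable_fun setT (fun w => (V w)%:E) by exact/measurable_EFinP.
have V0' w : setT w -> 0 <= (V w)%:E by rewrite lee_fin.
have momentQ : \int[P]_w (V w * q w * `|noise w| `^ (1 + eps))%:E
    = \int[P]_w (V w * q w * nu w `^ (1 + eps))%:E.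
  apply: (ge0_integral_weighted _ mpow _ mnuO moment Vq0 mVq) => w;
  exact: powR_ge0.
have mmom (k : Omega -> R) : measurable_fun setT k ->
    measurable_fun setT (fun w => (V w * q w * k w)%:E).
  by move=> mk; apply/measurable_EFinP/measurable_funM.
have mom0 (k : Omega -> R) w : setT w -> 0 <= (V w * q w * k w `^ (1 + eps))%:E.
  by rewrite lee_fin mulr_ge0 ?powR_ge0.
have mVm : measurable_fun setT (fun w => (V w * m w)%:E).
  by apply/measurable_EFinP/measurable_funM.
have Vm0 w : setT w -> 0 <= (V w * m w)%:E by rewrite lee_fin mulr_ge0.
have mom_noise0 := mom0 (fun w => `|noise w|%R).
have mmom_noise := mmom _ mpow.
apply: (le_trans step1).
under eq_integral do rewrite EFinD.
rewrite (ge0_integralD P measurableT V0' mVE mom_noise0 mmom_noise) momentQ.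
apply: (@le_trans _ _ (\int[P]_w ((V w)%:E + (V w * m w)%:E))).
  rewrite (ge0_integralD P measurableT V0' mVE Vm0 mVm) leeD2l//.
  apply: (ae_ge0_le_integral measurableT (mom0 _) (mmom _ mnuO) Vm0 mVm).
  apply: filterS qm => w qmw _.
  by rewrite lee_fin -mulrA ler_wpM2l.
apply: (ge0_le_integral P measurableT).
- by move=> w _; rewrite adde_ge0 ?V0' ?Vm0.
- exact: emeasurable_funD.
- apply/measurable_EFinP; exact: (sub_measurable_fun G_measurable).
(* The compensator closes the step: (1 + m) exp (- m) <= 1. *)
move=> w _; rewrite -EFinD lee_fin -{1}[V w]mulr1 -mulrDr /V -mulrA.
rewrite ler_piMr// expRN ler_pdivrMl ?expR_gt0// mulr1.
exact: expR_ge1Dx.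
Qed.

End Weighted.

(** [W] is the exponential of the compensated sum. X <= 1 and m >= 0 give W_k <= e^k, the bound on
    the weight at the next step; as the compensators sum to at most M, the tail event forces W_n >=
    e^l. *)
Lemma supermartingale_tail (d : measure_display) (Omega : measurableType d)
    (R : realType) (P : probability Omega R) (F : nat -> set (set Omega))
    (n : nat) (eps C M l : R) (noise nu X a q m : nat -> Omega -> R) :
  is_filtration F ->
  (forall s, (1 <= s <= n)%N ->
    is_cond_exp P (F s.-1) (noise s) (fun=> 0) /\
    is_cond_exp P (F s.-1) (fun w => `|noise s w| `^ (1 + eps))
                           (fun w => nu s w `^ (1 + eps))) ->
  (forall s, (1 <= s <= n)%N ->
    sub_measurable (F s) (noise s) /\ sub_measurable (F s) (X s)) ->
  (forall s, (1 <= s <= n)%N ->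
    [/\ sub_measurable (F s.-1) (a s), sub_measurable (F s.-1) (q s)
      & sub_measurable (F s.-1) (m s)]) ->
  (forall s w, (1 <= s <= n)%N ->
    [/\ `|a s w| <= C, 0 <= q s w, 0 <= m s w & X s w <= 1]) ->
  (forall s w, (1 <= s <= n)%N -> expR (X s w) <= 1 + a s w * noise s w
     + q s w * `|noise s w| `^ (1 + eps)) ->
  (forall s, (1 <= s <= n)%N ->
     {ae P, forall w, q s w * nu s w `^ (1 + eps) <= m s w}) ->
  (forall w, \sum_(1 <= s < n.+1) m s w <= M) ->
  measurable [set w | M + l <= \sum_(1 <= s < n.+1) X s w] /\
  (P [set w | M + l <= \sum_(1 <= s < n.+1) X s w]%R <= (expR (- l))%:E)%E.
Proof.
move=> [F_sigma F_meas F_mono] cond mFs mFp bounds expX qm mM.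
pose W k w := expR (\sum_(1 <= s < k.+1) (X s w - m s w)).
have mOF k Y : sub_measurable (F k) Y <->
    measurable_fun [set: g_sigma_algebraType (F k)]
      (Y : g_sigma_algebraType (F k) -> R) by exact: sub_measurableP.
have Fle k k' (Y : Omega -> R) : (k <= k')%N -> sub_measurable (F k) Y -> sub_measurable (F k') Y.
  by move=> kk' h B mB; apply: (F_mono _ _ kk'); exact: h.
have WS k w : W k.+1 w = W k w * expR (X k.+1 w - m k.+1 w).
  by rewrite /W -expRD (big_nat_recr k.+1).
have W_meas k : (k <= n)%N -> sub_measurable (F k) (W k).
  elim: k => [_|k IH kn].
    apply/mOF; rewrite /W; under eq_fun do rewrite big_geq//.
    exact: measurable_cst.
  have k1 : (1 <= k.+1 <= n)%N by [].
  have [_ mX] := mFs _ k1; have [_ _ mm] := mFp _ k1.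
  apply/mOF; rewrite (funext (WS k)); apply: measurable_funM.
    apply/mOF; exact: (Fle k k.+1 _ (leqnSn k) (IH (ltnW kn))).
  apply: measurableT_comp => //; apply: measurable_funB; first exact/mOF.
  apply/mOF; exact: (Fle k k.+1 _ (leqnSn k) mm).
have W_le k w : (k <= n)%N -> 0 <= W k w <= expR k%:R.
  move=> kn; rewrite expR_ge0/= ler_expR.
  rewrite (le_trans (y := \sum_(1 <= s < k.+1) (1 : R)))//; last first.
    by rewrite sumr_const_nat subn1.
  apply: ler_sum_nat => s /andP[s1 sk].
  have hs : (1 <= s <= n)%N by rewrite s1 (leq_trans _ kn).
  by have [_ _ m0 X1] := bounds s w hs; lra.
have intW k : (k <= n)%N -> (\int[P]_w (W k w)%:E <= 1)%E.
  elim: k => [_|k IH kn].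
    rewrite (eq_integral (cst 1%E)); last by move=> w _; rewrite /W big_geq// expR0.
    by rewrite integral_cst// mul1e probability_le1.
  have k1 : (1 <= k.+1 <= n)%N by [].
  have [mn mX] := mFs _ k1; have [ma mq mm] := mFp _ k1.
  have [c1 c2] := cond _ k1.
  rewrite (le_trans _ (IH (ltnW kn)))//.
  under eq_integral do rewrite WS.
  apply: (@exp_moment_step _ _ _ P (F k) (F_sigma k) (F_meas k) eps
    (noise k.+1) (nu k.+1) (W k) (X k.+1) (a k.+1) (q k.+1) (m k.+1)
    (expR k%:R) C) => //.
  - exact: sub_measurable_fun (F_meas k.+1) mn.
  - exact: sub_measurable_fun (F_meas k.+1) mX.
  - exact: (W_meas k (ltnW kn)).
  - by move=> w; rewrite W_le// ltnW.
  - by move=> w; have [] := bounds _ w k1.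
  - by move=> w; have [] := bounds _ w k1.
  - by move=> w; have [] := bounds _ w k1.
  - by move=> w; exact: expX.
  - exact: qm.
have mX s : (1 <= s <= n)%N -> measurable_fun setT (X s).
  by move=> /mFs[_]; exact: sub_measurable_fun.
have mSX : measurable_fun setT (fun w => \sum_(1 <= s < n.+1) X s w).
  (* Measurability of X is known only for 1 <= s <= n, so the summand is set to 0 elsewhere. *)
  rewrite (_ : (fun w => _) = (fun w => \sum_(s <- index_iota 1 n.+1)
     (if (1 <= s <= n)%N then X s w else 0))); last first.
    apply/funext => w; apply: eq_big_nat => s; rewrite ltnS => -> //.
  apply: measurable_sum => s; case: (boolP (1 <= s <= n)%N) => hs.
    exact: mX.
  exact: measurable_cst.
set A := [set w | _].
have mA : measurable A.
  rewrite (_ : A = setT `&` (fun w => \sum_(1 <= s < n.+1) X s w) @^-1` `[M + l, +oo[%classic); last first.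
    by rewrite setTI; apply/seteqP; split => w /=; rewrite in_itv/= andbT.
  exact: mSX.
split=> //.
have mW : measurable_fun setT (W n).
  exact: sub_measurable_fun (F_meas n) (W_meas n (leqnn n)).
have h : ((expR l)%:E * P A <= 1)%E.
  rewrite (le_trans _ (intW n (leqnn n)))//.
  rewrite -integral_cst//.
  apply: (@le_trans _ _ (\int[P]_(w in A) (W n w)%:E)%E).
    apply: ge0_le_integral => //.
    - by move=> w _; rewrite lee_fin expR_ge0.
    - by apply/measurable_EFinP/measurable_funTS.
    - move=> w /= Aw; rewrite lee_fin ler_expR sumrB lerBrDl.
      by rewrite (le_trans _ Aw)// lerD2r.
  apply: ge0_subset_integral => //; first exact/measurable_EFinP.
  by move=> w _; rewrite lee_fin expR_ge0.
rewrite expRN -[(expR l)^-1]mulr1 EFinM.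
by rewrite lee_pdivlMl ?expR_gt0.
Qed.

(** * Measurability of the procedure *)

Section Measurability.
Context {dT : measure_display} {O : measurableType dT} {R : realType} {d : nat}.
Implicit Types (f g : O -> R) (X Y : O -> 'cV[R]_d) (M : O -> 'M[R]_d).

Definition measurable_vec X := forall i, measurable_fun setT (fun w => X w i 0).
Definition measurable_mx M := forall i j, measurable_fun setT (fun w => M w i j).

(** The power -1 is measurable on the whole line and agrees with the inverse on nonnegative reals, 0
    included. *)
Lemma measurable_inv_ge0 f : (forall w, 0 <= f w) -> measurable_fun setT f ->
  measurable_fun setT (fun w => (f w)^-1).
Proof.
move=> f0 mf; rewrite (_ : (fun w => _) = (fun w => f w `^ (-1))).
  exact: (measurableT_comp (measurable_powR _) mf).
by apply/funext => w; rewrite powR_inv1.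
Qed.

Lemma measurable_sqrt f : measurable_fun setT f ->
  measurable_fun setT (fun w => Num.sqrt (f w)).
Proof.
move=> mf; rewrite (_ : (fun w => _) = (fun w => Num.max (f w) 0 `^ 2^-1)).
  apply: (measurableT_comp (measurable_powR _)).
  by apply: measurable_maxr => //; exact: measurable_cst.
apply/funext => w; rewrite powR12_sqrt ?le_max ?lexx ?orbT//.
by case: (leP (f w) 0) => // h; rewrite sqrtr0 ler0_sqrtr.
Qed.

Lemma measurable_dotv X Y : measurable_vec X -> measurable_vec Y ->
  measurable_fun setT (fun w => dotv (X w) (Y w)).
Proof.
move=> mX mY; under eq_fun do rewrite dotvE.
by apply: measurable_sum => i; exact: measurable_funM.
Qed.

Lemma measurable_mulmx M X : measurable_mx M -> measurable_vec X ->
  measurable_vec (fun w => M w *m X w).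
Proof.
move=> mM mX i; under eq_fun do rewrite mxE.
by apply: measurable_sum => j; exact: measurable_funM.
Qed.

Lemma measurable_scale f X : measurable_fun setT f -> measurable_vec X ->
  measurable_vec (fun w => f w *: X w).
Proof.
by move=> mf mX i; under eq_fun do rewrite mxE; exact: measurable_funM.
Qed.

Lemma measurable_mnorm M X : measurable_mx M -> measurable_vec X ->
  measurable_fun setT (fun w => mnorm (M w) (X w)).
Proof.
move=> mM mX; apply: measurable_sqrt.
by apply: measurable_dotv => //; exact: measurable_mulmx.
Qed.

Lemma measurable_inv_update M X :
  (forall w, 0 <= dotv (X w) (M w *m X w)) ->
  measurable_mx M -> measurable_vec X ->
  measurable_mx (fun w => inv_update (M w) (X w)).
Proof.
move=> pos mM mX i j; have mMX := measurable_mulmx mM mX.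
rewrite (_ : (fun w => _) = (fun w => M w i j
   - (1 + dotv (X w) (M w *m X w))^-1
     * ((M w *m X w) i 0 * (M w *m X w) j 0))).
  apply: measurable_funB; first exact: mM.
  apply: measurable_funM; last exact: measurable_funM.
  apply: measurable_inv_ge0; first by move=> w; rewrite addr_ge0.
  apply: measurable_funD; first exact: measurable_cst.
  exact: measurable_dotv.
apply/funext => w; rewrite /inv_update /rank1 mxE mxE mxE [X in _ - _ * X]mxE.
by rewrite big_ord1 [(_^T) _ _]mxE.
Qed.

Variables (p : ahr_params R) (nuhat noise : nat -> O -> R).
Variable phi : nat -> O -> 'cV[R]_d.
Hypotheses (lambda_gt0 : 0 < ahr_lambda p) (smin_gt0 : 0 < ahr_sigma_min p).
Hypothesis tau0_gt0 : 0 < ahr_tau0 p.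
Variable n : nat.
Hypothesis nuhat_meas : forall s, (1 <= s <= n)%N -> measurable_fun setT (nuhat s).
Hypothesis phi_meas : forall s, (1 <= s <= n)%N -> measurable_vec (phi s).

(** Stated relative to the previous K, since sigma and K are defined by mutual recursion;
    [measurable_ahr_K] closes the induction. *)
Lemma measurable_ahr_sigma_of_K s : (1 <= s <= n)%N ->
  measurable_mx (fun w => ahr_K p (nuhat^~ w) (phi^~ w) s.-1) ->
  measurable_fun setT (fun w => ahr_sigma p (nuhat^~ w) (phi^~ w) s).
Proof.
move=> hs mK.
rewrite (_ : (fun w => _) = (fun w =>
  let r := mnorm (ahr_K p (nuhat^~ w) (phi^~ w) s.-1) (phi s w) in
  Num.max (nuhat s w) (Num.max (ahr_sigma_min p) (Num.max (r / ahr_c0 p)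
    (Num.sqrt (ahr_L p * ahr_B p) / (ahr_c1 p `^ 4^-1
        * (2 * ahr_kappa (d := d) p * ahr_b p ^+ 2) `^ 4^-1) * Num.sqrt r))))).
  have mr := measurable_mnorm mK (phi_meas hs).
  apply: measurable_maxr; first exact: nuhat_meas.
  apply: measurable_maxr; first exact: measurable_cst.
  apply: measurable_maxr; apply: measurable_funM => //; try exact: measurable_cst.
  exact: measurable_sqrt.
by apply/funext => w; rewrite /ahr_sigma /ahr_sigma_step/= invmx_ahr_H.
Qed.

Lemma measurable_ahr_u_of_sigma s : (1 <= s <= n)%N ->
  measurable_fun setT (fun w => ahr_sigma p (nuhat^~ w) (phi^~ w) s) ->
  measurable_vec (fun w => ahr_u p (nuhat^~ w) (phi^~ w) s).
Proof.
move=> hs ms; apply: measurable_scale; last exact: phi_meas.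
by apply: measurable_inv_ge0 => // w; rewrite ltW// ahr_sigma_gt0.
Qed.

Lemma measurable_ahr_K k : (k <= n)%N ->
  measurable_mx (fun w => ahr_K p (nuhat^~ w) (phi^~ w) k).
Proof.
elim: k => [_ i j|k IH kn]; first exact: measurable_cst.
have mK := IH (ltnW kn).
apply: measurable_inv_update => //; first by move=> w; exact: ahr_K_ge0.
by apply: measurable_ahr_u_of_sigma => //; exact: measurable_ahr_sigma_of_K.
Qed.

Lemma measurable_ahr_sigma s : (1 <= s <= n)%N ->
  measurable_fun setT (fun w => ahr_sigma p (nuhat^~ w) (phi^~ w) s).
Proof.
move=> hs; apply: measurable_ahr_sigma_of_K => //; apply: measurable_ahr_K.
by case/andP: hs => _; apply: leq_trans; exact: leq_pred.
Qed.

Lemma measurable_ahr_u s : (1 <= s <= n)%N ->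
  measurable_vec (fun w => ahr_u p (nuhat^~ w) (phi^~ w) s).
Proof.
by move=> hs; apply: measurable_ahr_u_of_sigma => //; exact: measurable_ahr_sigma.
Qed.

Lemma measurable_ahr_w s : (1 <= s <= n)%N ->
  measurable_fun setT (fun w => ahr_w p (nuhat^~ w) (phi^~ w) s).
Proof.
move=> hs; rewrite (_ : (fun w => _) = (fun w =>
  mnorm (ahr_K p (nuhat^~ w) (phi^~ w) s.-1)
        (ahr_u p (nuhat^~ w) (phi^~ w) s))).
  apply: measurable_mnorm; last exact: measurable_ahr_u.
  apply: measurable_ahr_K.
  by case/andP: hs => _; apply: leq_trans; exact: leq_pred.
by apply/funext => w; rewrite /ahr_w invmx_ahr_H.
Qed.

Lemma measurable_ahr_v s : (1 <= s <= n)%N ->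
  measurable_fun setT (fun w => ahr_v p (nuhat^~ w) (phi^~ w) s).
Proof.
move=> hs; have mw := measurable_funX 2 (measurable_ahr_w hs).
apply: measurable_funM => //; apply: measurable_inv_ge0.
  by move=> w; rewrite addr_ge0 ?sqr_ge0.
by apply: measurable_funD => //; exact: measurable_cst.
Qed.

Lemma measurable_ahr_itau s : (1 <= s <= n)%N ->
  measurable_fun setT (fun w => ahr_itau p (nuhat^~ w) (phi^~ w) s).
Proof.
move=> hs; apply: measurable_funM; last exact: measurable_cst.
by apply: measurable_sqrt; exact: measurable_ahr_v.
Qed.

Lemma measurable_ahr_z s : (1 <= s <= n)%N -> measurable_fun setT (noise s) ->
  measurable_fun setT (fun w => ahr_z p (nuhat^~ w) (phi^~ w) (noise^~ w) s).
Proof.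
move=> hs mn; apply: measurable_funM => //; apply: measurable_inv_ge0.
  by move=> w; rewrite ltW// ahr_sigma_gt0.
exact: measurable_ahr_sigma.
Qed.

Lemma measurable_ahr_abs_z s : (1 <= s <= n)%N -> measurable_fun setT (noise s) ->
  measurable_fun setT (fun w => `|ahr_z p (nuhat^~ w) (phi^~ w) (noise^~ w) s|
    * ahr_itau p (nuhat^~ w) (phi^~ w) s).
Proof.
move=> hs mn; apply: measurable_funM; last exact: measurable_ahr_itau.
exact: (measurableT_comp (@normr_measurable R setT) (measurable_ahr_z hs mn)).
Qed.

Lemma measurable_ahr_psi s : (1 <= s <= n)%N -> measurable_fun setT (noise s) ->
  measurable_fun setT (fun w => ahr_psi p (nuhat^~ w) (phi^~ w) (noise^~ w) s).
Proof.
move=> hs mn; apply: measurable_funM; first exact: measurable_ahr_z.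
apply: measurable_inv_ge0; first by move=> w; rewrite le_max ler01.
apply: measurable_maxr; first exact: measurable_cst.
exact: measurable_ahr_abs_z.
Qed.

Lemma measurable_ahr_S k : (k <= n)%N ->
  (forall s, (1 <= s <= k)%N -> measurable_fun setT (noise s)) ->
  measurable_vec (fun w => ahr_S p (nuhat^~ w) (phi^~ w) (noise^~ w) k).
Proof.
elim: k => [|k IH] kn mn i.
  rewrite (_ : (fun w => _) = cst 0); first exact: measurable_cst.
  by apply/funext => w; rewrite /ahr_S big_geq// mxE.
rewrite (_ : (fun w => _) = (fun w =>
  ahr_S p (nuhat^~ w) (phi^~ w) (noise^~ w) k i 0
  + ahr_psi p (nuhat^~ w) (phi^~ w) (noise^~ w) k.+1
    * ahr_u p (nuhat^~ w) (phi^~ w) k.+1 i 0)); last first.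
  by apply/funext => w; rewrite /ahr_S (big_nat_recr k.+1)//= mxE [X in _ + X]mxE.
apply: measurable_funD.
  apply: IH; first exact: ltnW.
  by move=> s /andP[s1 sk]; apply: mn; rewrite s1 ltnW.
apply: measurable_funM.
  by apply: measurable_ahr_psi => //; apply: mn; rewrite leqnn.
exact: measurable_ahr_u.
Qed.

Lemma measurable_ahr_Z k : (k <= n)%N ->
  (forall s, (1 <= s <= k)%N -> measurable_fun setT (noise s)) ->
  measurable_fun setT (fun w => ahr_Z p (nuhat^~ w) (phi^~ w) (noise^~ w) k).
Proof.
move=> kn mn; apply: measurable_mnorm; first exact: measurable_ahr_K.
exact: measurable_ahr_S.
Qed.

Lemma measurable_ahr_g s : (1 <= s <= n)%N ->
  (forall r, (1 <= r < s)%N -> measurable_fun setT (noise r)) ->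
  measurable_fun setT (fun w => ahr_g p (nuhat^~ w) (phi^~ w) (noise^~ w) s).
Proof.
case: s => // s hs mn; apply: measurable_dotv; first exact: measurable_ahr_u.
apply: measurable_mulmx; first by apply: measurable_ahr_K; exact: ltnW.
by apply: measurable_ahr_S; first exact: ltnW.
Qed.

Lemma measurable_ahr_coef (delta : R) t s : 0 <= ln (2 * (ahr_T p)%:R ^+ 2 / delta) ->
  (1 <= s <= n)%N ->
  (forall r, (1 <= r < s)%N -> measurable_fun setT (noise r)) ->
  measurable_fun setT
    (fun w => ahr_coef p delta (nuhat^~ w) (noise^~ w) (phi^~ w) t s).
Proof.
move=> ell0; case: s => // s hs mn; apply: measurable_funM; last exact: measurable_cst.
apply: measurable_funM; first exact: measurable_cst.
apply: measurable_funM; first exact: measurable_ahr_g.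
have a0 : 0 <= ahr_alpha p delta t.
  by rewrite mulr_ge0// mulr_ge0// mulr_ge0 ?powR_ge0// ltW.
apply: measurable_inv_ge0 => [w|].
  by rewrite mulr_ge0 ?addr_ge0 ?sqr_ge0// le_max a0.
apply: measurable_funM.
  apply: measurable_funD; first exact: measurable_cst.
  exact: (measurable_funX 2 (measurable_ahr_w hs)).
apply: measurable_maxr; first exact: measurable_cst.
by apply: measurable_ahr_Z; first exact: ltnW.
Qed.

Lemma measurable_ahr_X1 s : (1 <= s <= n)%N -> measurable_fun setT (noise s) ->
  measurable_fun setT (fun w => ahr_X1 p (nuhat^~ w) (noise^~ w) (phi^~ w) s).
Proof.
move=> hs mn; apply: measurable_funM; first exact: measurable_cst.
apply: measurable_funM; last exact: measurable_cst.
apply: measurable_funM; last exact: measurable_ahr_v.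
rewrite (_ : (fun w => _) = (fun w =>
  if 2^-1 < `|ahr_z p (nuhat^~ w) (phi^~ w) (noise^~ w) s|
       * ahr_itau p (nuhat^~ w) (phi^~ w) s then 1 else 0)).
  apply: measurable_fun_ifT; try exact: measurable_cst.
  apply: measurable_fun_ltr; first exact: measurable_cst.
  exact: measurable_ahr_abs_z.
by apply/funext => w; case: ifP.
Qed.

Lemma measurable_ahr_X2 t s : (1 <= s <= n)%N -> measurable_fun setT (noise s) ->
  measurable_fun setT (fun w => ahr_X2 p (nuhat^~ w) (noise^~ w) (phi^~ w) t s).
Proof.
move=> hs mn; apply: measurable_funM; first exact: measurable_cst.
apply: measurable_funM; last exact: measurable_cst.
apply: measurable_funM; last exact: measurable_ahr_v.
exact: (measurable_funX 2 (measurable_ahr_psi hs mn)).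
Qed.

End Measurability.

Lemma ahr_tail_bounds
  (d0 : measure_display) (Omega : measurableType d0) (R : realType)
  (P : probability Omega R) (F : nat -> set (set Omega))
  (hF : is_filtration F)
  (d : nat) (p : ahr_params R) (delta : R)
  (d_ge1 : (1 <= d)%N) (T_ge1 : (1 <= ahr_T p)%N)
  (eps_itv : 0 < ahr_eps p <= 1) (L_gt0 : 0 < ahr_L p) (B_gt0 : 0 < ahr_B p)
  (lambda_gt0 : 0 < ahr_lambda p) (smin_gt0 : 0 < ahr_sigma_min p)
  (b_gt0 : 0 < ahr_b p) (delta_itv : 0 < delta < 1)
  (noise nu nuhat : nat -> Omega -> R) (phi : nat -> Omega -> 'cV[R]_d)
  (hnoise_meas : forall t, (1 <= t)%N -> sub_measurable (F t) (noise t))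
  (hphi_meas : forall t, (1 <= t)%N -> sub_measurable_vec (F t.-1) (phi t))
  (hphi_ball : forall t w, (1 <= t)%N -> ball2 (ahr_L p) (phi t w))
  (hnoise_mean : forall t, (1 <= t)%N ->
     is_cond_exp P (F t.-1) (noise t) (fun=> 0))
  (hnu_ge0 : forall t w, (1 <= t)%N -> 0 <= nu t w)
  (hnoise_moment : forall t, (1 <= t)%N ->
     is_cond_exp P (F t.-1) (fun w => `|noise t w| `^ (1 + ahr_eps p))
                            (fun w => nu t w `^ (1 + ahr_eps p)))
  (hnuhat_meas : forall t, (1 <= t)%N -> sub_measurable (F t.-1) (nuhat t))
  (hratio : {ae P, forall w, forall t, (1 <= t <= ahr_T p)%N ->
     nu t w <= ahr_b p * nuhat t w})
  (c0E : ahr_c0 p = 1 / Num.sqrt (23 * ln (2 * (ahr_T p)%:R ^+ 2 / delta)))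
  (c1E : ahr_c1 p =
     ln (3 * (ahr_T p)%:R) `^ ((1 - ahr_eps p) / (1 + ahr_eps p))
     / (48 * ln (2 * (ahr_T p)%:R ^+ 2 / delta) `^ (2 / (1 + ahr_eps p))))
  (tau0E : ahr_tau0 p = Num.sqrt (2 * ahr_kappa (d := d) p) * ahr_b p
     * ln (3 * (ahr_T p)%:R) `^ ((1 - ahr_eps p) / (2 * (1 + ahr_eps p)))
     / ln (2 * (ahr_T p)%:R ^+ 2 / delta) `^ (1 / (1 + ahr_eps p)))
  (t : nat) (ht : (1 <= t <= ahr_T p)%N) :
  let ell := ln (2 * (ahr_T p)%:R ^+ 2 / delta) in
  let tail (k : R) (X : Omega -> nat -> R) :=
    [set w | k * ell + ell <= \sum_(1 <= s < t.+1) X w s] in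
  let unlikely A := measurable A /\ (P A <= (expR (- ell))%:E)%E in
  [/\ unlikely (tail 4 (fun w => ahr_X1 p (nuhat^~ w) (noise^~ w) (phi^~ w))),
      unlikely (tail 1 (fun w => ahr_X2 p (nuhat^~ w) (noise^~ w) (phi^~ w) t)) &
      unlikely (tail 1 (fun w => ahr_X3 p delta (nuhat^~ w) (noise^~ w) (phi^~ w) t))].
Proof.
move=> ell tail unlikely; have [F_sigma F_meas F_mono] := hF.
have ell_gt0 : 0 < ell by exact: ahr_ell_gt0.
have tau0_gt0 : 0 < ahr_tau0 p.
  exact: (ahr_tau0_gt0 d_ge1 T_ge1 L_gt0 lambda_gt0 smin_gt0 b_gt0 delta_itv tau0E).
(* The measurability lemmas are applied on the type carrying [F s.-1] for predictable factors, and
   on that of [F s] for the increments. *)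
have F_sub k k' (Y : Omega -> R) : (k <= k')%N -> sub_measurable (F k) Y ->
    measurable_fun [set: g_sigma_algebraType (F k')] Y.
  move=> kk' h; apply/sub_measurableP => // A mA.
  by apply: (F_mono _ _ kk'); exact: h.
have pred_le k r s : (1 <= r <= s)%N -> (s.-1 <= k)%N -> (r.-1 <= k)%N.
  by move=> /andP[r1 rs]; apply: leq_trans; rewrite -!subn1 leq_sub2r.
have nuhatF k s : (s.-1 <= k)%N -> forall r, (1 <= r <= s)%N ->
    measurable_fun [set: g_sigma_algebraType (F k)] (nuhat r).
  move=> sk r rs; apply: (F_sub r.-1); first exact: pred_le rs sk.
  by apply: hnuhat_meas; case/andP: rs.
have phiF k s : (s.-1 <= k)%N -> forall r, (1 <= r <= s)%N ->
    measurable_vec (phi r : g_sigma_algebraType (F k) -> 'cV[R]_d).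
  move=> sk r rs i; apply: (F_sub r.-1); first exact: pred_le rs sk.
  by apply: hphi_meas; case/andP: rs.
have noiseF k r : (1 <= r <= k)%N ->
    measurable_fun [set: g_sigma_algebraType (F k)] (noise r).
  by move=> /andP[r1 rk]; apply: (F_sub r) => //; exact: hnoise_meas.
have noiseFp s r : (1 <= r < s)%N ->
    measurable_fun [set: g_sigma_algebraType (F s.-1)] (noise r).
  case: s => [|s]; first by rewrite ltn0 andbF.
  by rewrite ltnS; exact: noiseF.
have phiL w s : (1 <= s <= ahr_T p)%N -> norm2 (phi s w) <= ahr_L p.
  by move=> /andP[s1 _]; exact: hphi_ball.
have t_le s : (1 <= s <= t)%N -> (1 <= s <= ahr_T p)%N.
  by case/andP: ht => _ tT /andP[-> st]; exact: leq_trans st tT.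
(* Chosen so that q |noise|^(1 + eps) is [ahr_moment]; [m] dominates q nu^(1 + eps) almost
   everywhere, by the assumption on nu / nuhat. *)
pose q s w := (ahr_itau p (nuhat^~ w) (phi^~ w) s
  / ahr_sigma p (nuhat^~ w) (phi^~ w) s) `^ (1 + ahr_eps p).
pose m s w := ahr_moment_bound p (nuhat^~ w) (phi^~ w) s.
have itauF s : (1 <= s <= t)%N ->
    measurable_fun [set: g_sigma_algebraType (F s.-1)]
      (fun w => ahr_itau p (nuhat^~ w) (phi^~ w) s).
  move=> /andP[s1 _]; apply: (measurable_ahr_itau lambda_gt0 smin_gt0 (n := s)).
  - exact: nuhatF.
  - exact: phiF.
  - by rewrite s1 leqnn.
have isigmaF s : (1 <= s <= t)%N ->
    measurable_fun [set: g_sigma_algebraType (F s.-1)]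
      (fun w => (ahr_sigma p (nuhat^~ w) (phi^~ w) s)^-1).
  move=> /andP[s1 _]; apply: measurable_inv_ge0 => [w|].
    by rewrite ltW// ahr_sigma_gt0.
  apply: (measurable_ahr_sigma lambda_gt0 smin_gt0 (n := s)).
  - exact: nuhatF.
  - exact: phiF.
  - by rewrite s1 leqnn.
have qF s : (1 <= s <= t)%N ->
    measurable_fun [set: g_sigma_algebraType (F s.-1)] (q s).
  move=> hs; apply: (measurableT_comp (measurable_powR _)).
  by apply: measurable_funM; [exact: itauF | exact: isigmaF].
have mF s : (1 <= s <= t)%N ->
    measurable_fun [set: g_sigma_algebraType (F s.-1)] (m s).
  move=> hs; apply: (measurableT_comp (measurable_powR _)).
  by apply: measurable_funM; [exact: measurable_cst | exact: itauF].
have q_ge0 s w : 0 <= q s w by exact: powR_ge0.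
have m_ge0 s w : 0 <= m s w by exact: powR_ge0.
have q_noise s w : q s w * `|noise s w| `^ (1 + ahr_eps p)
    = ahr_moment p (nuhat^~ w) (noise^~ w) (phi^~ w) s.
  exact: (ahr_moment_noise d_ge1 T_ge1 L_gt0 lambda_gt0 smin_gt0 b_gt0 delta_itv tau0E).
have q_nu s : (1 <= s <= t)%N ->
    {ae P, forall w, q s w * nu s w `^ (1 + ahr_eps p) <= m s w}.
  move=> hs; apply: filterS hratio => w hw.
  apply: (ahr_moment_nu d_ge1 T_ge1 eps_itv L_gt0 lambda_gt0 smin_gt0 b_gt0 delta_itv tau0E).
    by apply: hnu_ge0; case/andP: hs.
  exact/hw/t_le.
have m_sum w : \sum_(1 <= s < t.+1) m s w <= ell.
  apply: (ahr_moment_bound_sum_le d_ge1 T_ge1 eps_itv L_gt0 lambda_gt0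
    smin_gt0 b_gt0 delta_itv tau0E) => //; first by case/andP: ht.
  exact: phiL.
pose C := (ahr_tau0 p * ahr_sigma_min p)^-1.
have C_ge0 : 0 <= C by rewrite invr_ge0 ltW// mulr_gt0.
have tailP (k : R) (X a : nat -> Omega -> R) : 0 <= k ->
    (forall s, (1 <= s <= t)%N ->
      measurable_fun [set: g_sigma_algebraType (F s)] (X s)) ->
    (forall s, (1 <= s <= t)%N ->
      measurable_fun [set: g_sigma_algebraType (F s.-1)] (a s)) ->
    (forall s w, (1 <= s <= t)%N -> `|a s w| <= C /\ X s w <= 1) ->
    (forall s w, (1 <= s <= t)%N -> expR (X s w) <= 1 + a s w * noise s w
      + k * ahr_moment p (nuhat^~ w) (noise^~ w) (phi^~ w) s) ->
    unlikely [set w | k * ell + ell <= \sum_(1 <= s < t.+1) X s w].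
  move=> k0 mX ma bd expX.
  apply: (@supermartingale_tail _ _ _ P F t (ahr_eps p) C (k * ell) ell
    noise nu X a (fun s w => k * q s w) (fun s w => k * m s w)) => //.
  - by move=> s /andP[s1 _]; split; [exact: hnoise_mean | exact: hnoise_moment].
  - move=> s hs; split; first by apply: hnoise_meas; case/andP: hs.
    by apply/sub_measurableP => //; exact: mX.
  - move=> s hs; split; apply/sub_measurableP => //; first exact: ma.
      by apply: measurable_funM; [exact: measurable_cst | exact: qF].
    by apply: measurable_funM; [exact: measurable_cst | exact: mF].
  - by move=> s w hs; have [? ?] := bd s w hs; split => //; exact: mulr_ge0.
  - by move=> s w hs; rewrite -mulrA q_noise; exact: expX.
  - move=> s hs; apply: filterS (q_nu s hs) => w qw.
    by rewrite -mulrA ler_wpM2l.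
  - by move=> w; rewrite -big_distrr/= ler_wpM2l.
have s_pred s : (s.-1 <= s)%N by exact: leq_pred.
have zero_meas s : (1 <= s <= t)%N ->
    measurable_fun [set: g_sigma_algebraType (F s.-1)] (fun=> 0 : R).
  by move=> _; exact: measurable_cst.
have half1 x : 0 <= x <= 2^-1 -> x <= 1 :> R by move=> /andP[? ?]; lra.
split.
- apply: (tailP 4 (fun s w => ahr_X1 p (nuhat^~ w) (noise^~ w) (phi^~ w) s)
    (fun=> fun=> 0)) => //.
  + move=> s /andP[s1 _].
    apply: (measurable_ahr_X1 lambda_gt0 smin_gt0 (n := s)).
    * exact: nuhatF.
    * exact: phiF.
    * by rewrite s1 leqnn.
    * by apply: noiseF; rewrite s1 leqnn.
  + move=> s w /andP[s1 _]; rewrite normr0; split=> //; apply: half1.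
    exact: (ahr_X1_exp d_ge1 T_ge1 eps_itv L_gt0 lambda_gt0 smin_gt0 b_gt0
      delta_itv c0E tau0E _ _ _ s1).1.
  + move=> s w /andP[s1 _]; rewrite mul0r addr0.
    exact: (ahr_X1_exp d_ge1 T_ge1 eps_itv L_gt0 lambda_gt0 smin_gt0 b_gt0
      delta_itv c0E tau0E _ _ _ s1).2.
- apply: (tailP 1 (fun s w => ahr_X2 p (nuhat^~ w) (noise^~ w) (phi^~ w) t s)
    (fun=> fun=> 0)) => //.
  + move=> s /andP[s1 _].
    apply: (measurable_ahr_X2 lambda_gt0 smin_gt0 (n := s)).
    * exact: nuhatF.
    * exact: phiF.
    * by rewrite s1 leqnn.
    * by apply: noiseF; rewrite s1 leqnn.
  + move=> s w hs; rewrite normr0; split=> //; apply: half1.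
    exact: (ahr_X2_exp d_ge1 T_ge1 eps_itv L_gt0 lambda_gt0 smin_gt0 b_gt0
      delta_itv tau0E _ _ _ hs).1.
  + move=> s w hs; rewrite mul0r addr0 mul1r.
    exact: (ahr_X2_exp d_ge1 T_ge1 eps_itv L_gt0 lambda_gt0 smin_gt0 b_gt0
      delta_itv tau0E _ _ _ hs).2.
pose coef s w := ahr_coef p delta (nuhat^~ w) (noise^~ w) (phi^~ w) t s.
have coefF s : (1 <= s <= t)%N ->
    measurable_fun [set: g_sigma_algebraType (F s.-1)] (coef s).
  move=> /andP[s1 _].
  apply: (measurable_ahr_coef lambda_gt0 smin_gt0 tau0_gt0 (n := s)).
  - exact: nuhatF.
  - exact: phiF.
  - exact: ltW.
  - by rewrite s1 leqnn.
  - exact: noiseFp.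
apply: (tailP 1 (fun s w => ahr_X3 p delta (nuhat^~ w) (noise^~ w) (phi^~ w) t s)
  (fun s w => coef s w / ahr_sigma p (nuhat^~ w) (phi^~ w) s)) => //.
- move=> s hs; have /andP[s1 _] := hs; apply: measurable_funM.
    have := coefF s hs; move/(sub_measurableP _ (F_sigma _)).
    exact: F_sub.
  apply: (measurable_ahr_psi lambda_gt0 smin_gt0 (n := s)).
  + exact: nuhatF.
  + exact: phiF.
  + by rewrite s1 leqnn.
  + by apply: noiseF; rewrite s1 leqnn.
- by move=> s hs; apply: measurable_funM; [exact: coefF | exact: isigmaF].
- move=> s w hs; split.
    exact: (ahr_coef_noise_bound d_ge1 T_ge1 eps_itv L_gt0 lambda_gt0 smin_gt0
      b_gt0 delta_itv tau0E).
  exact: (ahr_X3_exp d_ge1 T_ge1 eps_itv L_gt0 lambda_gt0 smin_gt0 b_gt0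
      delta_itv tau0E _ _ _ hs).1.
move=> s w hs; rewrite mul1r -mulrA [_^-1 * _]mulrC.
exact: (ahr_X3_exp d_ge1 T_ge1 eps_itv L_gt0 lambda_gt0 smin_gt0 b_gt0
      delta_itv tau0E _ _ _ hs).2.
Qed.

Theorem theorem3p3
  (d0 : measure_display) (Omega : measurableType d0) (R : realType)
  (P : probability Omega R) (F : nat -> set (set Omega))
  (hF : is_filtration F)
  (d T : nat) (hd : (1 <= d)%N) (hT : (1 <= T)%N)
  (eps L B lambda sigma_min b delta c0 c1 tau0 : R)
  (heps : 0 < eps <= 1) (hL : 0 < L) (hB : 0 < B)
  (hlambda : 0 < lambda) (hsigma_min : 0 < sigma_min) (hb : 0 < b)
  (hdelta : 0 < delta < 1)
  (y noise nu nuhat : nat -> Omega -> R)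
  (phi theta : nat -> Omega -> 'cV[R]_d) (theta_star : 'cV[R]_d)
  (htheta_star : ball2 B theta_star)
  (hy_meas : forall t, (1 <= t)%N -> sub_measurable (F t) (y t))
  (hnoise_meas : forall t, (1 <= t)%N -> sub_measurable (F t) (noise t))
  (hphi_meas : forall t, (1 <= t)%N -> sub_measurable_vec (F t.-1) (phi t))
  (hphi_ball : forall t w, (1 <= t)%N -> ball2 L (phi t w))
  (hmodel : forall t w, (1 <= t)%N ->
     y t w = dotv (phi t w) theta_star + noise t w)
  (hnoise_mean : forall t, (1 <= t)%N ->
     is_cond_exp P (F t.-1) (noise t) (fun=> 0))
  (hnu_ge0 : forall t w, (1 <= t)%N -> 0 <= nu t w)
  (hnoise_moment : forall t, (1 <= t)%N ->
     is_cond_exp P (F t.-1) (fun w => `|noise t w| `^ (1 + eps))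
                            (fun w => nu t w `^ (1 + eps)))
  (hnuhat_meas : forall t, (1 <= t)%N -> sub_measurable (F t.-1) (nuhat t))
  (hnuhat_ge0 : forall t w, (1 <= t)%N -> 0 <= nuhat t w)
  (hratio : {ae P, forall w, forall t, (1 <= t <= T)%N ->
     nu t w <= b * nuhat t w}) :
  let p := AhrParams T eps L B lambda sigma_min c0 c1 tau0 b in
  let ell := ln (2 * T%:R ^+ 2 / delta) in
  c0 = 1 / Num.sqrt (23 * ell) ->
  c1 = ln (3 * T%:R) `^ ((1 - eps) / (1 + eps))
         / (48 * ell `^ (2 / (1 + eps))) ->
  tau0 = Num.sqrt (2 * ahr_kappa (d := d) p) * b
           * ln (3 * T%:R) `^ ((1 - eps) / (2 * (1 + eps)))
           / ell `^ (1 / (1 + eps)) ->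
  (forall t w, (1 <= t <= T)%N ->
     is_ahr_estimator p (nuhat^~ w) (phi^~ w) (y^~ w) t (theta t w)) ->
  with_prob_ge P (1 - 3 * delta)
    [set w | forall t, (1 <= t <= T)%N ->
       mnorm (ahr_H p (nuhat^~ w) (phi^~ w) t) (theta t w - theta_star)
         <= ahr_beta d p delta t].
Proof.
move=> p ell c0E c1E tau0E hest.
have [hF1 _ _] := hF.
pose good t w := [/\
  \sum_(1 <= s < t.+1) ahr_X1 p (nuhat^~ w) (noise^~ w) (phi^~ w) s < 4 * ell + ell,
  \sum_(1 <= s < t.+1) ahr_X2 p (nuhat^~ w) (noise^~ w) (phi^~ w) t s < ell + ell &
  \sum_(1 <= s < t.+1) ahr_X3 p delta (nuhat^~ w) (noise^~ w) (phi^~ w) t s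
    < ell + ell].
have tails t : (1 <= t <= T)%N -> exists A : set Omega,
    [/\ measurable A, (P A <= (3 * expR (- ell))%:E)%E & ~` A `<=` good t].
  move=> ht.
  have [] := @ahr_tail_bounds _ _ _ P F hF d p delta hd hT heps hL hB
    hlambda hsigma_min hb hdelta noise nu nuhat phi hnoise_meas hphi_meas
    hphi_ball hnoise_mean hnu_ge0 hnoise_moment hnuhat_meas hratio c0E c1E
    tau0E t ht.
  rewrite -/ell.
  set A1 := [set w | _]; set A2 := [set w | _]; set A3 := [set w | _].
  move=> [m1 P1] [m2 P2] [m3 P3].
  exists (A1 `|` A2 `|` A3); split.
  - by apply: measurableU => //; exact: measurableU.
  - have mA12 : measurable (A1 `|` A2) by exact: measurableU.
    rewrite (le_trans (measureU2 _ mA12 m3))//.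
    rewrite (le_trans (leeD (measureU2 _ m1 m2) (lexx _)))//.
    rewrite (le_trans (leeD (leeD P1 P2) P3))// -!EFinD lee_fin.
    by lra.
  - move=> w /= nA; split; rewrite ltNge; apply/negP => h; apply: nA.
    + by left; left.
    + by left; right; rewrite /A2/= mul1r.
    + by right; rewrite /A3/= mul1r.
(* Index i stands for time i + 1; from T on [set0] is a dummy value. *)
have /choice[A hA] : forall i : nat, exists A : set Omega, (i < T)%N ->
    [/\ measurable A, (P A <= (3 * expR (- ell))%:E)%E & ~` A `<=` good i.+1].
  move=> i; case: (ltnP i T) => iT; last by exists set0.
  by have [A hA] := tails i.+1 iT; exists A.
pose bad := \big[setU/set0]_(i < T) A i.
have mbad : measurable bad.
  by apply: bigsetU_measurable => i _; have [] := hA i (ltn_ord i).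
exists (~` bad).
  split; first exact: measurableC.
  move=> w wbad t /andP[t1 tT].
  have T_pos s : (1 <= s <= T)%N -> (s.-1 < T)%N by case: s.
  have w_good s : (1 <= s <= T)%N -> good s w.
    move=> hs; have [_ _ sub] := hA _ (T_pos s hs).
    case/andP: hs => s1 sT; rewrite -(prednK s1); apply: sub => wA; apply: wbad.
    rewrite /bad -bigcup_mkord; exists s.-1 => //=.
    by rewrite prednK.
  apply: (@ahr_good_path R d p delta hd hT heps hL hB hlambda hsigma_min hb
    hdelta c0E c1E tau0E (nuhat^~ w) (noise^~ w) (phi^~ w) (y^~ w)
    (theta^~ w) theta_star htheta_star) => //.
  - by move=> s /andP[s1 _]; exact: hphi_ball.
  - by move=> s /andP[s1 _]; exact: hmodel.
  - by move=> s hs; exact: hest.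
  - by rewrite t1.
rewrite probability_setC//.
(* T times 3 exp (- ell) is 3 delta / (2T), at most 3 delta. *)
have Pbad : (P bad <= (3 * delta)%:E)%E.
  have mA i : (i < T)%N -> measurable (A i) by move=> /hA[].
  apply: (le_trans (Boole_inequality P mA)).
  apply: (@le_trans _ _ (\sum_(i < T) (3 * expR (- ell))%:E)%E).
    by apply: lee_sum => i _; have [] := hA i (ltn_ord i).
  rewrite sumEFin lee_fin sumr_const card_ord -[leLHS]mulr_natl.
  have T1 : 1 <= T%:R :> R by rewrite ler1n.
  have T0 : 0 < T%:R :> R by rewrite (lt_le_trans ltr01).
  case/andP: hdelta => d0' _.
  have -> : expR (- ell) = delta / (2 * T%:R ^+ 2).
    rewrite expRN /ell lnK ?invf_div// posrE divr_gt0// mulr_gt0// exprn_gt0//.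
  have -> : T%:R * (3 * (delta / (2 * T%:R ^+ 2))) = 3 * delta / (2 * T%:R).
    by field; rewrite gt_eqF.
  rewrite ler_pdivrMr ?mulr_gt0//; nra.
rewrite EFinB; apply: leeB => //.
Qed.
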